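(* Let $\lambda=(\lambda_1,\dots,\lambda_M)\in\Lambda$. Then the allocation vector $p^n=(p^n_k)_{1\le k\le K}$ generated by the update $$p^{n+1}=\big[p^n+\beta^n U^{n+1}\big]_{\mathcal C_{\varepsilon_0}},\qquad U^{n+1}_k=\mathbf 1_{E^n_k}\sum_{(i',i)\in\mathcal H_k}\Delta Q^{n+1}_{(i',i)}\quad(1\le k\le K),$$ converges almost surely, as $n\to\infty$, to $p^*=(p^*_k)_{1\le k\le K}$, where $p^*_k=\nu_k/\mu_k$.
   Context: Network. There are $M$ job classes; class $m$ is a finite connected directed acyclic graph $\mathcal G_m=(\mathcal V_m,\mathcal E_m)$, the sets $\mathcal V_m$ being disjoint, with $\bigcup_m\mathcal V_m=\{1,\dots,K\}$ (nodes, i.e. task types) and $\mathcal E=\bigcup_m\mathcal E_m$. $m(k)$ is the class of node $k$; $\mathcal P_k=\{k':(k',k)\in\mathcal E\}$ is the set of parents of $k$; $k$ is a root if $\mathcal P_k=\emptyset$. There are $J$ servers; $\mathcal S_k\ne\emptyset$ is the set of servers able to serve node $k$, and $\mathcal T_j=\{k: j\in\mathcal S_k\}\neq\emptyset$. For $j\in\mathcal S_k$ the service rate is $\mu_{kj}=\mu_k\alpha_j$ with finite $\mu_k,\alpha_j>0$, and (after scaling time) $\sum_{j\in\mathcal S_k}\mu_{kj}<1$ for all $k$. Class-$m$ jobs have arrival rate $\lambda_m\in(0,1)$; $\nu_k:=\lambda_{m(k)}$. Capacity region. $\Lambda$ is the set of $\lambda\in\mathbb R_+^M$ for which there exist $p_{kj}\ge0$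 with $\sum_{k\in\mathcal T_j}p_{kj}\le1$ for all $j$ and $\nu_k\le\sum_{j\in\mathcal S_k}\mu_{kj}p_{kj}$ for all $k$. Queues and dynamics (discrete time $n=0,1,2,\dots$). There is one queue, with non-negative integer length $Q^n_{(k',k)}$, for each edge $(k',k)\in\mathcal E$, and one queue with length $Q^n_{(0,k)}$ for each root $k$; initial lengths are arbitrary and deterministic. $E^n_k$ is the event that a type-$k$ task is available: $E^n_k=\{Q^n_{(0,k)}>0\}$ if $k$ is a root, $E^n_k=\{Q^n_{(k',k)}>0\ \forall k'\in\mathcal P_k\}$ otherwise. Let $a^n_m\in\{0,1\}$ be the number of class-$m$ arrivals and $d^n_k\in\{0,1\}$ the number of type-$k$ tasks processed at time $n$. Then $Q^{n+1}_{(0,k)}=Q^n_{(0,k)}+a^n_{m(k)}-d^n_k$ for roots $k$, $Q^{n+1}_{(k',k)}=Q^n_{(k',k)}+d^n_{k'}-d^n_k$ for edges, and $\Delta Q^{n+1}_{(k',k)}=Q^{n+1}_{(k',k)}-Q^n_{(k',k)}$. Here $d^n_k=s^n_k\mathbf 1_{E^n_k}$, where, conditionally on the history up to time $n$ (all queue lengths and allocation vectors at times $\le n$), the variables $a^n_m$ ($1\le m\le M$) and $s^n_k$ ($1\le k\le K$) are independent Bernoulli with parameters $\lambda_m$ and $\mu_kp^n_k$ respectively. Policy. $p_k=\sum_{j\in\mathcal S_k}\alpha_jp_{kj}$ is the total capacity allocated to node $k$. $\mathcal C$ is the set of $p\in\mathbb R^K$ for which there exist $p_{kj}\ge0$ with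 $\sum_{j\in\mathcal S_k}\alpha_jp_{kj}=p_k$ for all $k$ and $\sum_{k\in\mathcal T_j}p_{kj}\le1$ for all $j$. Fix $\varepsilon_0>0$ with $\nu_k/\mu_k\ge\varepsilon_0$ for all $k$, and let $\mathcal C_{\varepsilon_0}=\{p\in\mathcal C: p_k\ge\varepsilon_0\ \forall k\}$; $[x]_{\mathcal C_{\varepsilon_0}}$ is the Euclidean projection of $x\in\mathbb{R}^K$ onto $\mathcal C_{\varepsilon_0}$. For each $k$, $\mathcal H_k$ is the set of queues on a fixed (arbitrarily chosen) path $(0,i_1),(i_1,i_2),\dots,(i_{L-1},i_L)$ with $i_1$ a root, $i_L=k$, and $(i_l,i_{l+1})\in\mathcal E$ (for $k$ a root, $\mathcal H_k=\{(0,k)\}$). $(\beta^n)$ is a positive decreasing sequence with $\sum_n\beta^n=\infty$, $\sum_n(\beta^n)^2<\infty$, and $\lim_{n\to\infty}\frac1{n\beta^n}$ existing and finite. The initial vector $p^0\in\mathcal C$ is arbitrary. *)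

(* Defs.v *)
From HB Require Import structures.
From mathcomp Require Import all_boot all_order all_algebra.
From mathcomp Require Import all_classical all_reals all_analysis.

Set Implicit Arguments.
Unset Strict Implicit.
Unset Printing Implicit Defensive.
Import Order.TTheory GRing.Theory Num.Theory.
Import numFieldNormedType.Exports.
Local Open Scope classical_set_scope.
Local Open Scope ring_scope.

(* The node set of class [m] is the fibre [[set k | class_of k == m]]: the
   node sets are thus disjoint and cover all the nodes, and [edge] is the
   union of the edge sets of the class graphs. *)
Record network (R : realType) := Network {
  nclass : nat;
  nnode : nat;
  nserver : nat;
  class_of : 'I_nnode -> 'I_nclass;
  edge : rel 'I_nnode;
  servers : 'I_nnode -> {set 'I_nserver};
  mu : 'I_nnode -> R;
  alpha : 'I_nserver -> R;
  class_nonempty : forall m, exists k, class_of k = m;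
  edge_class : forall k k', edge k k' -> class_of k = class_of k';
  class_connected : forall k k', class_of k = class_of k' ->
    connect [rel x y | edge x y || edge y x] k k';
  edge_acyclic : forall k s, ~~ cycle edge (k :: s);
  servers_nonempty : forall k, servers k != finset.set0;
  tasks_nonempty : forall j, exists k, j \in servers k;
  mu_gt0 : forall k, 0 < mu k;
  alpha_gt0 : forall j, 0 < alpha j;
  service_lt1 : forall k, \sum_(j in servers k) mu k * alpha j < 1 }.

Arguments class_of {R n}.
Arguments edge {R n}.
Arguments servers {R n}.
Arguments mu {R n}.
Arguments alpha {R n}.

Definition tasks R (N : network R) (j : 'I_(nserver N)) : {set 'I_(nnode N)} :=
  [set k | j \in servers k]%SET.

Definition parents R (N : network R) (k : 'I_(nnode N)) : {set 'I_(nnode N)} :=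
  [set k' | edge k' k]%SET.

Definition root R (N : network R) (k : 'I_(nnode N)) : bool :=
  parents k == finset.set0.

Definition nu R (N : network R) (lambda : 'I_(nclass N) -> R)
  (k : 'I_(nnode N)) : R := lambda (class_of k).

(* [q k j] is the fraction of its capacity that server [j] gives to node [k];
   only the entries with [j \in servers k] matter. *)
Definition allocation R (N : network R)
    (q : 'M[R]_(nnode N, nserver N)) : Prop :=
  (forall k j, j \in servers k -> 0 <= q k j) /\
  (forall j, \sum_(k in tasks j) q k j <= 1).

Definition capacity_region R (N : network R) : set ('I_(nclass N) -> R) :=
  [set lambda | (forall m, 0 <= lambda m) /\
     exists2 q, allocation q &
       forall k, nu lambda k <= \sum_(j in servers k) mu k * alpha j * q k j].

Definition feasible R (N : network R) : set 'rV[R]_(nnode N) :=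
  [set p | exists2 q, allocation q &
     forall k, \sum_(j in servers k) alpha j * q k j = p ord0 k].

Definition feasible_ge R (N : network R) (eps : R) : set 'rV[R]_(nnode N) :=
  [set p | feasible p /\ forall k, eps <= p ord0 k].

Definition euclidean_norm (R : realType) n (x : 'rV[R]_n) : R :=
  Num.sqrt (\sum_i x ord0 i ^+ 2).

Definition is_projection (R : realType) n (C : set 'rV[R]_n)
    (x y : 'rV[R]_n) : Prop :=
  C y /\ forall z, C z -> euclidean_norm (x - y) <= euclidean_norm (x - z).

(* The pair [(Some k', k)] names the queue of an edge from [k'] to [k], and
   [(None, k)] the external queue [(0, k)] of a root [k]. A family indexed by
   all pairs is only ever used at the pairs satisfying [is_queue]. *)
Definition queue R (N : network R) : Type :=
  (option 'I_(nnode N) * 'I_(nnode N))%type.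

Definition is_queue R (N : network R) (c : queue N) : bool :=
  if c.1 is Some k' then edge k' c.2 else root c.2.

(* The path [(0, i), (i, i_2), ...] through [i] and the successive nodes
   of [s]. *)
Definition path_queues R (N : network R) (i : 'I_(nnode N))
    (s : seq 'I_(nnode N)) : seq (queue N) :=
  (None, i) :: pairmap (fun x y => (Some x, y)) i s.

Definition is_root_path R (N : network R) (k : 'I_(nnode N))
    (H : seq (queue N)) : Prop :=
  exists i s, [/\ root i, path edge i s, last i s = k & H = path_queues i s].

Definition available R (N : network R) (L : queue N -> nat)
    (k : 'I_(nnode N)) : bool :=
  if root k then (0 < L (None, k))%N
  else [forall k' in parents k, (0 < L (Some k', k))%N].

Definition served R (N : network R) (L : queue N -> nat)
    (s : 'I_(nnode N) -> bool) (k : 'I_(nnode N)) : bool :=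
  s k && available L k.

Definition queue_input R (N : network R) (a : 'I_(nclass N) -> bool)
    (d : 'I_(nnode N) -> bool) (c : queue N) : bool :=
  if c.1 is Some k' then d k' else a (class_of c.2).

Definition increment R (N : network R) (L L' : queue N -> nat)
    (c : queue N) : int := (L' c)%:Z - (L c)%:Z.

(* [update_direction] at the queue lengths [L] of time [n] and [L'] of time
   [n.+1] is the vector [U^(n+1)]. *)
Definition update_direction R (N : network R)
    (H : 'I_(nnode N) -> seq (queue N)) (L L' : queue N -> nat) :
    'rV[R]_(nnode N) :=
  \row_k ((available L k)%:R * (\sum_(c <- H k) increment L L' c)%:~R).

Section probability.
Context d (T : measurableType d) (R : realType) (P : probability T R).

(* [g] is a version of the conditional probability of the event [B] given the
   sigma-algebra [F]. *)
Definition is_cond_prob (F : set (set T)) (B : set T) (g : T -> R) : Prop :=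
  [/\ forall Y : set R, measurable Y -> F (g @^-1` Y),
      P.-integrable setT (EFin \o g) &
      forall A, F A -> (\int[P]_(w in A) (g w)%:E = P (A `&` B))%E].

Context (N : network R).
Implicit Types (Q : nat -> queue N -> {RV P >-> nat})
  (p : nat -> 'I_(nnode N) -> {RV P >-> R})
  (a : nat -> 'I_(nclass N) -> {RV P >-> bool})
  (s : nat -> 'I_(nnode N) -> {RV P >-> bool}).

Definition lengths Q (n : nat) (w : T) : queue N -> nat := fun c => Q n c w.

Definition allocated p (n : nat) (w : T) : 'rV[R]_(nnode N) :=
  \row_k p n k w.

Definition history Q p (n : nat) : set (set T) :=
  <<s [set A | (exists i c Y,
                  [/\ (i <= n)%N, is_queue c & A = Q i c @^-1` Y]) \/
               (exists i k (Y : set R),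
                  [/\ (i <= n)%N, measurable Y & A = p i k @^-1` Y])] >>.

(* Conditionally on the history up to time [n], the joint law of all the
   arrivals and potential services at time [n] is a product of Bernoulli
   laws. *)
Definition cond_indep_bernoulli (lambda : 'I_(nclass N) -> R) Q p a s
    (n : nat) : Prop :=
  forall (x : 'I_(nclass N) -> bool) (y : 'I_(nnode N) -> bool),
    is_cond_prob (history Q p n)
      [set w | (forall m, a n m w = x m) /\ (forall k, s n k w = y k)]
      (fun w => (\prod_m bernoulli_pmf (lambda m) (x m)) *
                (\prod_k bernoulli_pmf (mu k * p n k w) (y k))).

Record scheduled_process (lambda : 'I_(nclass N) -> R) (eps0 : R)
    (beta : nat -> R) (H : 'I_(nnode N) -> seq (queue N))
    Q p a s : Prop := ScheduledProcess {
  queue_init : exists L0 : queue N -> nat,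
    forall c w, is_queue c -> Q 0%N c w = L0 c;
  alloc_init : exists2 p0, feasible p0 & forall w, allocated p 0%N w = p0;
  queue_step : forall n c w, is_queue c ->
    let d := served (lengths Q n w) (fun k => s n k w) in
    (Q n.+1 c w)%:Z =
      (Q n c w)%:Z + (queue_input (fun m => a n m w) d c)%:Z - (d c.2)%:Z;
  alloc_step : forall n w,
    is_projection (@feasible_ge R N eps0)
      (allocated p n w
         + beta n *: update_direction H (lengths Q n w) (lengths Q n.+1 w))
      (allocated p n.+1 w);
  randomness : forall n, cond_indep_bernoulli lambda Q p a s n }.

End probability.

(* Main.v *)
(* The increments along a path from a root telescope, so that the update
   direction is 1_(E_k) (a_m(k) - s_k), with conditional mean
   - mu_k 1_(E_k) (p_k - p*_k). As p* lies in the convex set onto which one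
   projects, X_n = |p^n - p*|^2 satisfies
     E[X_(n+1) | F_n] <= X_n + K beta_n^2 - 2 c beta_n 1_(V_n) X_n,
   where V_n is the event that all nodes are available. From any history, V
   occurs after as many steps as there are nodes with probability bounded below:
   it suffices that all the intermediate arrivals and services succeed. Since X
   cannot collapse in boundedly many steps, the negative drift dominates a
   multiple of beta_n E[X_n], and the divergence of the sum of the beta_n forces
   E[X_n] -> 0. Adding to X_n the tail of the series K beta_n^2 gives a
   nonnegative supermartingale, and Doob's maximal inequality turns convergence
   of the means into almost sure convergence. *)

Require Import Defs.
From mathcomp Require Import all_boot all_order all_algebra.
From mathcomp Require Import all_classical all_reals all_analysis.
From mathcomp Require Import measurable_realfun.
From mathcomp Require Import lra ring zify.
Import Order.TTheory GRing.Theory Num.Theory.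
Import numFieldNormedType.Exports.
Local Open Scope classical_set_scope.
Local Open Scope ring_scope.

Set Implicit Arguments.
Unset Strict Implicit.
Unset Printing Implicit Defensive.

(** * Expectation and conditioning of bounded random variables *)

Section BoundedExpectation.
Context d (T : measurableType d) (R : realType) (P : probability T R).
Implicit Types (f g h : T -> R) (A B : set T).

Definition bounded_mfun f :=
  measurable_fun setT f /\ exists M, forall w, `|f w| <= M.

Definition Ev f : R := \int[P]_w f w.

Lemma bounded_mfun_integrable f :
  bounded_mfun f -> P.-integrable setT (EFin \o f).
Proof.
move=> [mf [M fM]]; apply: measurable_bounded_integrable => //.
  by rewrite [X in (X < _)%E](@probability_setT _ _ _ P) ltry.
by exists M; split; [exact: num_real | move=> x /ltW Mx w _; exact: le_trans Mx].
Qed.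

Lemma bounded_mfun_cst r : bounded_mfun (cst r).
Proof. by split; [exact: measurable_cst | exists `|r|]. Qed.

Lemma bounded_mfunD f g :
  bounded_mfun f -> bounded_mfun g -> bounded_mfun (fun w => f w + g w).
Proof.
move=> [mf [M fM]] [mg [M' gM]]; split; first exact: measurable_funD.
by exists (M + M') => w; rewrite (le_trans (ler_normD _ _)) ?lerD.
Qed.

Lemma bounded_mfunN f : bounded_mfun f -> bounded_mfun (fun w => - f w).
Proof.
move=> [mf [M fM]]; split; first exact: measurable_funN.
by exists M => w; rewrite normrN.
Qed.

Lemma bounded_mfunB f g :
  bounded_mfun f -> bounded_mfun g -> bounded_mfun (fun w => f w - g w).
Proof. by move=> bf bg; apply: bounded_mfunD => //; exact: bounded_mfunN. Qed.

Lemma bounded_mfunM f g :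
  bounded_mfun f -> bounded_mfun g -> bounded_mfun (fun w => f w * g w).
Proof.
move=> [mf [M fM]] [mg [M' gM]]; split; first exact: measurable_funM.
by exists (M * M') => w; rewrite normrM ler_pM.
Qed.

Lemma bounded_mfun_indic A : measurable A -> bounded_mfun (\1_A : T -> R).
Proof.
move=> mA; split; first exact: measurable_indic.
by exists 1 => w; rewrite indicE; case: (_ \in _); rewrite ?normr1 ?normr0.
Qed.

Lemma bounded_mfun_sum (I : Type) (r : seq I) (F : I -> T -> R) :
  (forall i, bounded_mfun (F i)) ->
  bounded_mfun (fun w => \sum_(i <- r) F i w).
Proof.
move=> bF; elim: r => [|i r ih].
  by under eq_fun do rewrite big_nil; exact: bounded_mfun_cst.
by under eq_fun do rewrite big_cons; exact: bounded_mfunD.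
Qed.

Lemma bounded_mfun_prod (I : Type) (r : seq I) (F : I -> T -> R) :
  (forall i, bounded_mfun (F i)) ->
  bounded_mfun (fun w => \prod_(i <- r) F i w).
Proof.
move=> bF; elim: r => [|i r ih].
  by under eq_fun do rewrite big_nil; exact: bounded_mfun_cst.
by under eq_fun do rewrite big_cons; exact: bounded_mfunM.
Qed.

Lemma Ev_cst r : Ev (fun=> r) = r.
Proof. by rewrite /Ev Rintegral_cst// [X in fine X](@probability_setT _ _ _ P) mulr1. Qed.

Lemma eq_Ev f g : f =1 g -> Ev f = Ev g.
Proof. by move=> fg; apply: eq_Rintegral => w _. Qed.

Lemma EvD f g : bounded_mfun f -> bounded_mfun g ->
  Ev (fun w => f w + g w) = Ev f + Ev g.
Proof. by move=> bf bg; apply: RintegralD => //; exact: bounded_mfun_integrable. Qed.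

Lemma EvB f g : bounded_mfun f -> bounded_mfun g ->
  Ev (fun w => f w - g w) = Ev f - Ev g.
Proof. by move=> bf bg; apply: RintegralB => //; exact: bounded_mfun_integrable. Qed.

Lemma EvZ r f : bounded_mfun f -> Ev (fun w => r * f w) = r * Ev f.
Proof. by move=> bf; apply: RintegralZl => //; exact: bounded_mfun_integrable. Qed.

Lemma Ev_ge0 f : (forall w, 0 <= f w) -> 0 <= Ev f.
Proof. by move=> f0; apply: Rintegral_ge0. Qed.

Lemma le_Ev f g : bounded_mfun f -> bounded_mfun g ->
  (forall w, f w <= g w) -> Ev f <= Ev g.
Proof.
by move=> bf bg fg; apply: le_Rintegral => //; exact: bounded_mfun_integrable.
Qed.

Lemma Ev_sum (I : Type) (r : seq I) (F : I -> T -> R) :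
  (forall i, bounded_mfun (F i)) ->
  Ev (fun w => \sum_(i <- r) F i w) = \sum_(i <- r) Ev (F i).
Proof.
move=> bF; elim: r => [|i r ih].
  by rewrite big_nil (_ : (fun _ => _) = cst 0) ?Ev_cst//;
    apply/funext => w; rewrite big_nil.
rewrite big_cons -ih -EvD//; last exact: bounded_mfun_sum.
by apply: eq_Ev => w; rewrite big_cons.
Qed.

Lemma Ev_indic A : measurable A -> (Ev \1_A)%:E = P A.
Proof.
move=> mA; rewrite /Ev /Rintegral integral_indic// setIT fineK//.
by rewrite fin_num_measure.
Qed.

Lemma Ev_indicM A f : measurable A ->
  Ev (fun w => \1_A w * f w) = \int[P]_(w in A) f w.
Proof.
move=> mA; rewrite [RHS]Rintegral_mkcond; apply: eq_Ev => w.
by rewrite patch_indic mulrC.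
Qed.

(** * Testing against functions measurable for a sub-sigma-algebra *)

Section Conditioning.
Variable G : set (set T).
Hypothesis G_meas : G `<=` measurable.

Definition sub_mfun f := @measurable_fun _ _ (g_sigma_algebraType G) R setT f.

Lemma sub_measurable A : <<s G>> A -> measurable A.
Proof.
by apply: smallest_sub => //; exact: sigma_algebra_measurable.
Qed.

Lemma sub_mfun_ge f c : sub_mfun f -> <<s G>> [set w | c <= f w].
Proof.
move=> mf; have := mf measurableT `[c, +oo[%classic (measurable_itv _).
by rewrite setTI; congr (<<s _ >> _); apply/seteqP; split => w /=; rewrite in_itv/= andbT.
Qed.

Lemma sub_mfun_lt f c : sub_mfun f -> <<s G>> [set w | f w < c].
Proof.
move=> mf; have := mf measurableT `]-oo, c[%classic (measurable_itv _).
by rewrite setTI; congr (<<s _ >> _); apply/seteqP; split => w /=; rewrite in_itv.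
Qed.

Lemma sub_setI A B : <<s G>> A -> <<s G>> B -> <<s G>> (A `&` B).
Proof. exact: (@measurableI _ (g_sigma_algebraType G)). Qed.

(* Bisection of the range of [h]: on a set of [<<s G>>] where [h] varies by at
   most [r], replacing [h] by a constant costs at most [r * M * P A]. *)
Lemma Ev_bisect phi h M : bounded_mfun phi -> (forall w, `|phi w| <= M) ->
  bounded_mfun h -> sub_mfun h ->
  (forall A, <<s G>> A -> 0 <= Ev (fun w => \1_A w * phi w)) ->
  forall n A c r, <<s G>> A -> 0 <= c -> 0 <= r ->
    (forall w, A w -> c <= h w <= c + r) ->
    - (r / 2 ^+ n * M * Ev \1_A) <= Ev (fun w => \1_A w * (h w * phi w)).
Proof.
move=> bphi phiM bh mh phi0; elim=> [|n ih] A c r GA c0 r0 hcr.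
  have mA := sub_measurable GA; have bA := bounded_mfun_indic mA.
  rewrite expr0 divr1.
  have bAphi : bounded_mfun (fun w => \1_A w * phi w) by exact: bounded_mfunM.
  (* Write [h] as [c + (h - c)]: the constant part has a nonnegative contribution, and [h - c] is at
     most [r] on [A]. *)
  have e : 0 <= c * Ev (fun w => \1_A w * phi w).
    by rewrite mulr_ge0 ?phi0.
  rewrite -(addr0 (- _)) (le_trans (lerD (lexx _) e))//.
  rewrite -mulNr -!EvZ// -EvD; try by repeat apply: bounded_mfunM => //; exact: bounded_mfun_cst.
  apply: le_Ev; try by repeat (apply: bounded_mfunM || apply: bounded_mfunD) => //; exact: bounded_mfun_cst.
  move=> w; rewrite indicE; case: (boolP (w \in A)) => [|_]; last by rewrite !(mulr0, mul0r) addr0.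
  rewrite inE => /hcr /andP[h1 h2]; rewrite !mul1r mulr1.
  rewrite -lerBrDr -mulrBl.
  have : `|(h w - c) * phi w| <= r * M.
    by rewrite normrM ler_pM// ger0_norm ?subr_ge0// lerBlDl.
  by rewrite ler_norml => /andP[].
pose B := [set w | c + r / 2 <= h w].
have GB : <<s G>> B by exact: sub_mfun_ge.
pose B' := [set w | h w < c + r / 2].
have GB' : <<s G>> B' by exact: sub_mfun_lt.
have r2 : 0 <= r / 2 by rewrite divr_ge0.
have I1 := ih (A `&` B) (c + r / 2) (r / 2) (sub_setI GA GB) (addr_ge0 c0 r2) r2.
have I2 := ih (A `&` B') c (r / 2) (sub_setI GA GB') c0 r2.
have E0 w : \1_A w = \1_(A `&` B) w + \1_(A `&` B') w :> R.
  rewrite !indicE !in_setI; case: (w \in A) => //=; last by rewrite addr0.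
  have [h1|h1] := leP (c + r / 2) (h w).
    by rewrite mem_set// memNset ?addr0// /B' /= => /(le_lt_trans h1); rewrite ltxx.
  by rewrite memNset ?mem_set ?add0r// /B /= => /(lt_le_trans h1); rewrite ltxx.
have mAB := sub_measurable (sub_setI GA GB).
have mAB' := sub_measurable (sub_setI GA GB').
have bi := bounded_mfun_indic mAB; have bi' := bounded_mfun_indic mAB'.
have bhp : bounded_mfun (fun w => h w * phi w) by exact: bounded_mfunM.
have -> : Ev \1_A = Ev \1_(A `&` B) + Ev \1_(A `&` B').
  by rewrite -EvD//; apply: eq_Ev.
have -> : Ev (fun w => \1_A w * (h w * phi w)) =
    Ev (fun w => \1_(A `&` B) w * (h w * phi w)) +
    Ev (fun w => \1_(A `&` B') w * (h w * phi w)).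
  rewrite -EvD; try exact: bounded_mfunM.
  by apply: eq_Ev => w; rewrite E0 mulrDl.
rewrite mulrDr opprD exprS invfM mulrA; apply: lerD.
  apply: I1 => w [/hcr/andP[_ h1]]; rewrite /B /= => ->/=.
  by rewrite (le_trans h1)// -addrA -mulr2n -[X in _ <= _ + X]mulr_natr divfK.
by apply: I2 => w [/hcr/andP[-> _]]; rewrite /B' /= => /ltW.
Qed.

(** Extends the sign condition from indicators to [h]: the range [[0, r]] is bisected [n] times, and
    the loss, proportional to [r / 2 ^+ n], vanishes as [n] grows. *)
Lemma Ev_mul_ge0 phi h : bounded_mfun phi ->
  bounded_mfun h -> sub_mfun h -> (forall w, 0 <= h w) ->
  (forall A, <<s G>> A -> 0 <= Ev (fun w => \1_A w * phi w)) ->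
  0 <= Ev (fun w => h w * phi w).
Proof.
move=> bphi bh mh h0 phi0.
have [_ [M phiM]] := bphi; have [_ [r hr]] := bh.
have r0 : 0 <= r by apply: le_trans (hr point).
have GT : <<s G>> setT by exact: (@measurableT _ (g_sigma_algebraType G)).
have key n : - (r / 2 ^+ n * M * Ev \1_setT) <= Ev (fun w => h w * phi w).
  rewrite [leRHS](_ : _ = Ev (fun w => \1_setT w * (h w * phi w))).
    apply: (Ev_bisect bphi phiM bh mh phi0 _ GT (lexx 0) r0) => w _; rewrite h0 add0r.
    by rewrite (le_trans (ler_norm _)).
  by apply: eq_Ev => w; rewrite indicT mul1r.
have cv : - (r * M * Ev \1_setT * (2^-1 : R) ^+ n) @[n --> \oo] -->
    - (r * M * Ev \1_setT * 0).
  apply: cvgN; apply: cvgMl_tmp.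
  by apply: cvg_expr; rewrite ger0_norm ?invr_ge0// invf_lt1// ltr1n.
rewrite -oppr0 -(mulr0 (r * M * Ev \1_setT)).
apply: (cvgr_to_le cv); apply: nearW => n.
by rewrite exprVn (le_trans _ (key n))// [X in _ <= - X](_ : _ = r * M * Ev \1_setT / 2 ^+ n)//; ring.
Qed.

(** Adding to [h] its bound [M] makes it nonnegative and leaves the mean of the product unchanged,
    since [phi] has mean zero; the one-sided result then applies to both [phi] and [- phi]. *)
Lemma Ev_mul_eq0 phi h : bounded_mfun phi -> bounded_mfun h -> sub_mfun h ->
  (forall A, <<s G>> A -> Ev (fun w => \1_A w * phi w) = 0) ->
  Ev (fun w => h w * phi w) = 0.
Proof.
move=> bphi bh mh phi0; have [_ [M hM]] := bh.
pose h' w := h w + M.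
have bc : bounded_mfun (cst M) by exact: bounded_mfun_cst.
have bh' : bounded_mfun h' by exact: bounded_mfunD.
have mh' : sub_mfun h' by apply: measurable_funD => //; exact: measurable_cst.
have h'0 w : 0 <= h' w by have := hM w; rewrite ler_norml /h' => /andP[]; lra.
have bN := bounded_mfunN bphi.
have le0 := Ev_mul_ge0 bphi bh' mh' h'0.
have ge0 := Ev_mul_ge0 bN bh' mh' h'0.
have E0 : Ev phi = 0.
  have GT : <<s G>> setT by exact: (@measurableT _ (g_sigma_algebraType G)).
  by rewrite -(phi0 setT GT); apply: eq_Ev => w; rewrite indicT mul1r.
have E1 : Ev (fun w => h' w * phi w) = Ev (fun w => h w * phi w).
  rewrite (@eq_Ev _ (fun w => h w * phi w + M * phi w)); last first.
    by move=> w; rewrite -mulrDl.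
  rewrite EvD ?EvZ ?E0 ?mulr0 ?addr0//; first exact: bounded_mfunM.
  by apply: bounded_mfunM.
have E2 (g : T -> R) : bounded_mfun g ->
    Ev (fun w => g w * - phi w) = - Ev (fun w => g w * phi w).
  move=> bg; rewrite -mulN1r -EvZ; last exact: bounded_mfunM.
  by apply: eq_Ev => w; rewrite mulN1r mulrN.
apply/eqP; rewrite -E1 eq_le le0 ?andbT; last by move=> A /phi0 ->.
rewrite -oppr_ge0 -E2// ge0// => A GA; rewrite E2 ?phi0 ?oppr0//.
exact: bounded_mfun_indic (sub_measurable GA).
Qed.

End Conditioning.
End BoundedExpectation.
(** * Almost sure convergence of supermartingales *)

Section MaximalInequality.
Context d (T : measurableType d) (R : realType) (P : probability T R).
Variable G : nat -> set (set T).
Hypothesis G_meas : forall n, G n `<=` measurable.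
Hypothesis G_mono : forall i n, (i <= n)%N -> <<s G i>> `<=` <<s G n>>.
Variable Y : nat -> T -> R.
Hypothesis Y_ge0 : forall n w, 0 <= Y n w.
Hypothesis Y_bounded : forall n, bounded_mfun (Y n).
Hypothesis Y_adapted : forall n, sub_mfun (G n) (Y n).
Hypothesis Y_super : forall n A, <<s G n>> A ->
  Ev P (fun w => \1_A w * Y n.+1 w) <= Ev P (fun w => \1_A w * Y n w).

Definition stays_below (eps : R) n k : set T :=
  [set w | forall i, (i < k)%N -> Y (n + i) w < eps].

Lemma stays_belowS eps n k :
  stays_below eps n k.+1 = stays_below eps n k `&` [set w | Y (n + k) w < eps].
Proof.
apply/seteqP; split => w /=.
  by move=> h; split=> [i ik|]; apply: h => //; rewrite ltnS ltnW.
by move=> [h1 h2] i; rewrite ltnS leq_eqVlt => /orP[/eqP->//|/h1].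
Qed.

(** A window of length [k.+1] ends at time [n + k], so the event is already decided then and the
    supermartingale property from [n + k] to the next time can be used on it. *)
Lemma stays_below_sub eps n k : <<s G (n + k)>> (stays_below eps n k.+1).
Proof.
elim: k => [|k ih]; rewrite stays_belowS; apply: sub_setI.
- rewrite (_ : stays_below _ _ _ = setT); last by apply/seteqP; split.
  exact: (@measurableT _ (g_sigma_algebraType (G (n + 0)))).
- exact: sub_mfun_lt.
- by apply: G_mono ih; rewrite leq_add2l.
- exact: sub_mfun_lt.
Qed.

Lemma stays_below_measurable eps n k : measurable (stays_below eps n k).
Proof.
case: k => [|k].
  by rewrite (_ : stays_below _ _ _ = setT); last by apply/seteqP; split.
exact: (sub_measurable (@G_meas (n + k)) (@stays_below_sub eps n k)).
Qed.

Lemma maximal_inequality (eps : R) n k : 0 < eps ->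
  eps * (1 - Ev P \1_(stays_below eps n k)) <= Ev P (Y n).
Proof.
move=> eps0.
have bI j : bounded_mfun (\1_(stays_below eps n j) : T -> R).
  by apply: bounded_mfun_indic; exact: stays_below_measurable.
(* The induction on [k] needs the extra term: the mean of [Y (n + k)] over the paths that have not
   yet reached [eps]. *)
suff : eps * (1 - Ev P \1_(stays_below eps n k)) +
    Ev P (fun w => \1_(stays_below eps n k) w * Y (n + k) w) <= Ev P (Y n).
  by apply: le_trans; rewrite lerDl Ev_ge0// => w; rewrite mulr_ge0// indicE.
elim: k => [|k ih].
  rewrite (_ : stays_below _ _ _ = setT); last by apply/seteqP; split.
  rewrite indicT Ev_cst subrr mulr0 add0r addn0.
  by rewrite le_eqVlt; apply/orP; left; apply/eqP/eq_Ev => w; rewrite mul1r.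
apply: le_trans ih.
have := Y_super (@stays_below_sub eps n k); rewrite -addnS => S1.
have {S1} := le_trans (lerD (lexx _) S1); apply.
have bIY j : bounded_mfun (fun w => \1_(stays_below eps n j) w * Y (n + k) w).
  exact: bounded_mfunM.
(* The paths that leave the event at time [n + k] have [Y (n + k) >= eps] there, which pays for
   [eps] times their probability. *)
suff : eps * Ev P \1_(stays_below eps n k) +
    Ev P (fun w => \1_(stays_below eps n k.+1) w * Y (n + k) w) <=
    eps * Ev P \1_(stays_below eps n k.+1) +
    Ev P (fun w => \1_(stays_below eps n k) w * Y (n + k) w).
  by move=> h; lra.
rewrite -!EvZ// -!EvD //; try by apply: bounded_mfunM => //; exact: bounded_mfun_cst.
apply: le_Ev; try by apply: bounded_mfunD => //; apply: bounded_mfunM => //; exact: bounded_mfun_cst.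
move=> w; rewrite stays_belowS indicI /= /mul_fun.
rewrite !indicE; case: (w \in stays_below eps n k); last by rewrite !(mul0r, mulr0).
have [h|h] := ltP (Y (n + k) w) eps.
  by rewrite mem_set//= !mul1r.
by rewrite memNset /= ?ltNge ?h// !(mul0r, mulr0, mul1r, mulr1) addr0 add0r.
Qed.

Lemma supermartingale_ae_cvg0 : Ev P (Y n) @[n --> \oo] --> 0 ->
  {ae P, forall w, Y n w @[n --> \oo] --> 0}.
Proof.
move=> EY0.
(* [C eps n] says that [Y] reaches [eps] at some time from [n] on, and has probability at most
   [Ev P (Y n) / eps]. Hence [B eps], where this recurs forever, is negligible, and the values
   [1 / (j + 1)] of [eps] suffice for convergence. *)
pose C (eps : R) n : set T := \bigcup_k ~` stays_below eps n k.
pose B eps : set T := \bigcap_n C eps n.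
have mC eps n : measurable (C eps n).
  by apply: bigcup_measurable => k _; apply: measurableC; exact: stays_below_measurable.
have PC (eps : R) n : 0 < eps -> (P (C eps n) <= (Ev P (Y n) / eps)%:E)%E.
  move=> eps0.
  have ndC : nondecreasing_seq (fun k => ~` stays_below eps n k).
    move=> k m km; apply/subsetPset; apply: subsetC => w h i ik.
    by apply: h; exact: leq_trans km.
  have := nondecreasing_cvg_mu (mu := P)
    (fun k => measurableC (@stays_below_measurable eps n k)) (mC eps n) ndC.
  move=> /= cv; apply: (cvge_to_le cv); apply: nearW => k /=.
  rewrite probability_setC; last exact: stays_below_measurable.
  rewrite -(Ev_indic P (@stays_below_measurable _ _ _)) -EFinB lee_fin.
  by rewrite ler_pdivlMr// mulrC maximal_inequality.
have PB (eps : R) : 0 < eps -> P.-negligible (B eps).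
  move=> eps0; have mB : measurable (B eps).
    by apply: bigcap_measurable => // n _; exact: mC.
  apply/(negligibleP _ mB).
  apply/eqP; rewrite -measure_le0.
  have cv : (Ev P (Y n) / eps) @[n --> \oo] --> 0 / eps by exact: cvgMr_tmp.
  rewrite mul0r in cv.
  suff : fine (P (B eps)) <= 0 by rewrite -lee_fin fineK// fin_num_measure.
  apply: (cvgr_to_ge cv); apply: nearW => n.
  rewrite -lee_fin fineK ?fin_num_measure//; apply: le_trans (PC _ n eps0).
  by apply: le_measure; rewrite ?inE// => w; apply.
have : P.-negligible (\bigcup_j B (j.+1%:R^-1)).
  by apply: negligible_bigcup => j; apply: PB.
apply: negligibleS => w /= nw; apply: contrapT => nB; apply: nw.
apply/cvgr0Pnorm_lt => e e0.
have [j je] : exists j : nat, j.+1%:R^-1 < e by have [j] := ltr_add_invr e0; rewrite add0r; exists j.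
have : ~ B j.+1%:R^-1 w by move=> h; apply: nB; exists j.
move=> /existsNP[n] /not_implyP[_ nC].
near=> m; rewrite ger0_norm//; apply: lt_trans je.
apply: contrapT => h; apply: nC.
have nm : (n <= m)%N by near: m; exact: nbhs_infty_ge.
exists (m - n).+1 => // /(_ (m - n)%N (ltnSn _)).
by rewrite subnKC.
Unshelve. all: by end_near.
Qed.

End MaximalInequality.

(** * A deterministic recursion of Robbins-Monro type *)

Section RobbinsMonroSequence.
Context (R : realType) (beta e v : nat -> R).
Variables (kappa K ca cb : R) (L n0 : nat).
Hypothesis beta_gt0 : forall n, 0 < beta n.
Hypothesis beta_sum : series beta @ \oo --> +oo.
Hypothesis beta_sum2 : cvgn (series (fun n => beta n ^+ 2)).

(** The sum of [beta i ^+ 2] over [i >= n]; adding [K] times it absorbs the error terms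
    [K * beta n ^+ 2] and makes the recursion monotone. *)
Definition sq_tail n : R :=
  lim (series (fun n => beta n ^+ 2) @ \oo) - series (fun n => beta n ^+ 2) n.

Lemma sq_tailS n : sq_tail n = sq_tail n.+1 + beta n ^+ 2.
Proof. by rewrite /sq_tail /series/= big_nat_recr//=; ring. Qed.

Lemma sq_tail_cvg0 : sq_tail n @[n --> \oo] --> 0.
Proof.
rewrite -(subrr (lim (series (fun n => beta n ^+ 2) @ \oo))).
by apply: cvgB => //; exact: cvg_cst.
Qed.

Lemma sq_tail_ge0 n : 0 <= sq_tail n.
Proof.
rewrite subr_ge0; apply: nondecreasing_cvgn_le => //.
by apply/nondecreasing_seqP => m; rewrite /series/= big_nat_recr//= lerDl sqr_ge0.
Qed.

Lemma beta_sq_cvg0 : beta n ^+ 2 @[n --> \oo] --> 0.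
Proof. exact: cvg_series_cvg_0. Qed.

Hypothesis kappa_gt0 : 0 < kappa.
Hypothesis K_ge0 : 0 <= K.
Hypothesis ca_gt0 : 0 < ca.
Hypothesis e_ge0 : forall n, 0 <= e n.
Hypothesis v_ge0 : forall n, 0 <= v n.
Hypothesis e_step : forall n,
  e n.+1 <= e n - kappa * beta n * v n + K * beta n ^+ 2.
(** In the application [e n] is the mean of the squared error, [v n] its mean over the event that
    all nodes are available, and the lag [L] the number of nodes. *)
Hypothesis e_le : forall n, (n0 <= n)%N ->
  e n <= ca * v (n + L)%N + cb * beta n ^+ 2.

(* [e n + K * sq_tail n] is nonincreasing; if it stayed above [eta], [v] would
   be bounded below and the drift terms [kappa * beta n * v n] would not be
   summable. *)
Lemma robbins_monro_cvg0 : e n @[n --> \oo] --> 0.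
Proof.
pose y n := e n + K * sq_tail n.
have y_ge0 n : 0 <= y n by rewrite addr_ge0// mulr_ge0// sq_tail_ge0.
have y_step n : y n.+1 + kappa * beta n * v n <= y n.
  rewrite /y (sq_tailS n); have := e_step n; lra.
have kbv n : 0 <= kappa * beta n * v n by rewrite !mulr_ge0// ltW.
have y_decr n m : (n <= m)%N -> y m <= y n.
  move=> nm; rewrite -(subnKC nm); elim: (m - n)%N => [|k ih]; first by rewrite addn0.
  rewrite addnS (le_trans _ ih)// (le_trans _ (y_step _))// lerDl//.
apply/cvgr0Pnorm_lt => eta eta0.
suff [n yn] : exists n, y n < eta.
  near=> m; rewrite ger0_norm//.
  have nm : (n <= m)%N by near: m; exact: nbhs_infty_ge.
  rewrite (le_lt_trans _ yn)// (le_trans _ (y_decr _ _ nm))//.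
  by rewrite /y lerDl mulr_ge0// sq_tail_ge0.
apply: contrapT => /forallNP yeta.
(* Two error terms of at most [eta / 4] each leave [eta / 2] out of [y n >= eta] for
   [ca * v (n + L)]. *)
have [m [mn0 mt mb]] : exists m, [/\ (n0 <= m)%N,
    forall n, (m <= n)%N -> K * sq_tail n <= eta / 4 &
    forall n, (m <= n)%N -> cb * beta n ^+ 2 <= eta / 4].
  have c1 : K * sq_tail n @[n --> \oo] --> K * 0.
    by apply: cvgMl_tmp; exact: sq_tail_cvg0.
  have c2 : cb * beta n ^+ 2 @[n --> \oo] --> cb * 0.
    by apply: cvgMl_tmp; exact: beta_sq_cvg0.
  rewrite !mulr0 in c1 c2.
  have eta4 : 0 < eta / 4 by rewrite divr_gt0.
  have [a _ ha] := cvgr_le _ c1 _ eta4; have [b _ hb] := cvgr_le _ c2 _ eta4.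
  exists (maxn n0 (maxn a b)); split; first by rewrite leq_maxl.
  - by move=> n; rewrite !geq_max => /and3P[_ h _]; exact: ha.
  - by move=> n; rewrite !geq_max => /and3P[_ _ h]; exact: hb.
have v_low n : (m <= n)%N -> eta / 2 / ca <= v (n + L)%N.
  move=> mn; rewrite ler_pdivrMr// mulrC.
  have := yeta n; rewrite /y => /negP; rewrite -leNgt.
  have := e_le (leq_trans mn0 mn); have := mt _ mn; have := mb _ mn; lra.
pose c := kappa * (eta / 2 / ca).
have c0 : 0 < c by rewrite !(mulr_gt0, divr_gt0, invr_gt0).
have sum_le n : y (m + L + n)%N + c * \sum_(m + L <= i < m + L + n) beta i <= y (m + L)%N.
  elim: n => [|n ih]; first by rewrite addn0 big_geq// mulr0 addr0.
  apply: le_trans ih; rewrite addnS big_nat_recr ?leq_addr//=.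
  have mi : (m <= m + n)%N by rewrite leq_addr.
  have := y_step (m + L + n)%N; have := v_low _ mi; rewrite addnAC.
  move=> h1 h2; suff : c * beta (m + L + n)%N <= kappa * beta (m + L + n)%N * v (m + L + n)%N.
    by move: h2; lra.
  by rewrite /c mulrAC ler_wpM2l// mulr_ge0// ltW.
(* By [sum_le], the sum of [beta] beyond [m + L] never exceeds [y (m + L) / c]; divergence makes it
   exceed this by 1. *)
have : \forall n \near \oo, y (m + L)%N / c + series beta (m + L)%N + 1 <= series beta n.
  by move/cvgryPge : beta_sum; apply.
move=> [q _ hq]; have := hq (m + L + q)%N; rewrite /= leq_addl => /(_ isT).
apply/negP; rewrite -ltNge /series/= (@big_cat_nat _ _ _ (m + L)%N)//= ?leq_addr//.
have := sum_le q; have := y_ge0 (m + L + q)%N.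
set S := \sum_(m + L <= i < m + L + q) beta i => h1 h2.
have h3 : S <= y (m + L)%N / c by rewrite ler_pdivlMr// mulrC; lra.
lra.
Unshelve. all: by end_near.
Qed.

End RobbinsMonroSequence.

(** * Projection, feasibility and queue dynamics *)

Section Projection.
Context (R : realType) (n : nat).
Implicit Types (C : set 'rV[R]_n) (x y z : 'rV[R]_n).

Definition sqdist x y : R := \sum_i (x ord0 i - y ord0 i) ^+ 2.

Lemma sqdist_ge0 x y : 0 <= sqdist x y.
Proof. by apply: sumr_ge0 => i _; exact: sqr_ge0. Qed.

Lemma projection_sqdist_le C x y z :
  is_projection C x y -> C z -> sqdist x y <= sqdist x z.
Proof.
move=> [_ h] /h; rewrite /euclidean_norm ler_sqrt; last first.
  by apply: sumr_ge0 => i _; exact: sqr_ge0.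
by rewrite /sqdist; under eq_bigr do rewrite !mxE;
  under [X in _ <= X -> _]eq_bigr do rewrite !mxE.
Qed.

Definition is_convex C :=
  forall y z t, C y -> C z -> 0 <= t -> t <= 1 -> C (y + t *: (z - y)).

(** The inner product [b] of [x - y] and [z - y] is nonpositive, so expanding [sqdist x z] around
    [y] gives at least [sqdist y z]. *)
Lemma projection_contracts C x y z : is_convex C ->
  is_projection C x y -> C z -> sqdist y z <= sqdist x z.
Proof.
move=> cC pr Cz; have Cy : C y by case: pr.
pose b := \sum_i (x ord0 i - y ord0 i) * (z ord0 i - y ord0 i).
have eqz (t : R) : sqdist x (y + t *: (z - y)) =
    sqdist x y - 2 * t * b + t ^+ 2 * sqdist y z.
  rewrite /sqdist /b !mulr_sumr -sumrB -big_split/=.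
  by apply: eq_bigr => i _; rewrite !mxE; ring.
(* The derivative at [t = 0] of the squared distance from [x] to
   [y + t *: (z - y)] is nonnegative. *)
have hb (t : R) : 0 < t -> t <= 1 -> 2 * b <= t * sqdist y z.
  move=> t0 t1; have := projection_sqdist_le pr (cC _ _ _ Cy Cz (ltW t0) t1).
  by rewrite eqz => h; rewrite -(ler_pM2l t0); nra.
have b0 : b <= 0.
  rewrite leNgt; apply/negP => b0; have D0 := sqdist_ge0 y z.
  (* With [D] for [sqdist y z], the choice [t = b / (D + b)] is in [(0, 1]] even when [D = 0], and
     yields [2 * b <= t * D <= b], contradicting [b > 0]. *)
  have S0 : 0 < sqdist y z + b by rewrite ltr_wpDl.
  have t0 : 0 < b / (sqdist y z + b) by rewrite divr_gt0.
  have t1 : b / (sqdist y z + b) <= 1 by rewrite ler_pdivrMr// mul1r lerDr.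
  have := hb _ t0 t1.
  rewrite mulrAC ler_pdivlMr//; nra.
have -> : sqdist x z = sqdist x y - 2 * b + sqdist y z.
  by rewrite -[z in LHS](subrKC y) -[z - y]scale1r eqz; ring.
have := sqdist_ge0 x y; lra.
Qed.

End Projection.

(** * Feasible allocations and the target *)

Section Feasibility.
Context (R : realType) (N : network R).
Implicit Types p : 'rV[R]_(nnode N).

Lemma feasible_ge0 p k : feasible p -> 0 <= p ord0 k.
Proof.
move=> [q [q0 _] <-]; apply: sumr_ge0 => j kj.
by rewrite mulr_ge0 ?q0// ltW// alpha_gt0.
Qed.

Lemma feasible_mu_lt1 p k : feasible p -> mu k * p ord0 k < 1.
Proof.
move=> [q [q0 q1] <-]; apply: le_lt_trans (service_lt1 k).
rewrite mulr_sumr; apply: ler_sum => j kj; rewrite mulrA ler_piMr//.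
  by rewrite mulr_ge0// ltW// ?mu_gt0 ?alpha_gt0.
apply: le_trans (q1 j); rewrite (bigD1 k) ?inE//= lerDl.
by apply: sumr_ge0 => k' /andP[]; rewrite inE => jk' _; exact: q0.
Qed.

Lemma feasible_ge_convex eps : is_convex (@feasible_ge R N eps).
Proof.
move=> y z t [[q [q0 q1] qy] ye] [[r [r0 r1] rz] ze] t0 t1; split; last first.
  move=> k; rewrite !mxE; have := ye k; have := ze k; nra.
exists (q + t *: (r - q)); [split|].
- by move=> k j kj; rewrite !mxE; have := q0 _ _ kj; have := r0 _ _ kj; nra.
- move=> j; rewrite [leLHS](_ : _ = (1 - t) * (\sum_(k in tasks j) q k j) +
      t * \sum_(k in tasks j) r k j).
    by have := q1 j; have := r1 j; nra.
  by rewrite !mulr_sumr -big_split/=; apply: eq_bigr => k _; rewrite !mxE; ring.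
- move=> k; rewrite !mxE -qy -rz -sumrB mulr_sumr -big_split/=.
  by apply: eq_bigr => j _; rewrite !mxE; ring.
Qed.

(** An allocation witnessing the capacity condition may serve node [k] at a rate [S k] above
    [nu lambda k]; scaling its row by [nu lambda k / S k <= 1] gives equality and only lightens the
    servers. *)
Lemma target_feasible (lambda : 'I_(nclass N) -> R) eps :
  capacity_region lambda -> 0 < eps -> (forall k, eps <= nu lambda k / mu k) ->
  feasible_ge eps (\row_k (nu lambda k / mu k)).
Proof.
move=> [_ [q [q0 q1] qnu]] eps0 epsle; split; last by move=> k; rewrite mxE.
pose S k := \sum_(j in servers k) mu k * alpha j * q k j.
have nu0 k : 0 < nu lambda k.
  by rewrite -(divfK (lt0r_neq0 (mu_gt0 k)) (nu _ _)) mulr_gt0// ?mu_gt0//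
    (lt_le_trans eps0).
have S0 k : 0 < S k by rewrite (lt_le_trans (nu0 k))// qnu.
have f0 k : 0 <= nu lambda k / S k by rewrite divr_ge0// ltW.
exists (\matrix_(k, j) (q k j * (nu lambda k / S k))); [split|].
- by move=> k j kj; rewrite mxE mulr_ge0// q0.
- move=> j; apply: le_trans (q1 j); apply: ler_sum => k; rewrite inE => kj.
  by rewrite mxE ler_piMr ?q0// ler_pdivrMr// mul1r qnu.
- move=> k; rewrite mxE; under eq_bigr do rewrite mxE mulrA.
  rewrite -mulr_suml.
  have -> : \sum_(j in servers k) alpha j * q k j = S k / mu k.
    rewrite /S mulr_suml; apply: eq_bigr => j _.
    by field; rewrite lt0r_neq0// mu_gt0.
  by field; rewrite !lt0r_neq0// mu_gt0.
Qed.

End Feasibility.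

(** * Propagation of availability and telescoping of queue increments *)

Section Dynamics.
Context (R : realType) (N : network R).
Implicit Types (k : 'I_(nnode N)) (L : queue N -> nat).

Lemma path_class k t : path edge k t -> class_of (last k t) = class_of k.
Proof.
elim: t k => //= k' t ih k /andP[kk' /ih ->].
by rewrite (edge_class kk').
Qed.

Definition ancestors k : {set 'I_(nnode N)} := [set k' | connect edge k' k]%SET.

(** An integer height that increases strictly along edges by acyclicity; a node counts as its own
    ancestor, so ranks start at 1 and level 0 is vacuous. *)
Definition rank k : nat := #|ancestors k|.

Lemma rank_gt0 k : (0 < rank k)%N.
Proof. by apply/card_gt0P; exists k; rewrite inE connect0. Qed.

Lemma rank_edge k' k : edge k' k -> (rank k' < rank k)%N.
Proof.
move=> e; apply: proper_card; apply/properP; split.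
  by apply/fintype.subsetP => x; rewrite !inE => h; exact: connect_trans h (connect1 e).
exists k; rewrite inE ?connect0//; apply/negP => /connectP[t pt lt].
by have := edge_acyclic k t; rewrite /= rcons_path pt -lt e.
Qed.

Lemma rank_le k : (rank k <= nnode N)%N.
Proof. by rewrite (leq_trans (max_card _))// card_ord. Qed.

(* If everybody is served and all classes receive an arrival, availability
   propagates by one rank per time step, whatever the initial lengths. *)
Definition level_available L j : bool :=
  [forall k, (rank k <= j)%N ==> available L k].

Section Step.
Variables (L L' : queue N -> nat) (a : 'I_(nclass N) -> bool)
  (s : 'I_(nnode N) -> bool).
Hypothesis step : forall c, is_queue c ->
  (L' c)%:Z = (L c)%:Z + (queue_input a (served L s) c)%:Z - (served L s c.2)%:Z.

(* Each node on the path adds its services to one queue and removes them from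
   the previous one, so the sum telescopes. *)
Lemma path_increment k t : Defs.root k -> path edge k t ->
  \sum_(c <- path_queues k t) increment L L' c =
  (a (class_of k))%:Z - (served L s (last k t))%:Z.
Proof.
move=> rk; rewrite /path_queues big_cons {1}/increment step//=.
set d := served L s.
have -> : (L (None, k))%:Z + (a (class_of k))%:Z - (d k)%:Z - (L (None, k))%:Z =
  (a (class_of k))%:Z - (d k)%:Z by ring.
move=> pt; rewrite -addrA; congr (_ + _); elim: t {rk} k pt => [k _|k' t ih k /=].
  by rewrite big_nil addr0.
case/andP=> e pt; rewrite big_cons {1}/increment step//= -/d -(ih _ pt); ring.
Qed.

(** The path telescopes to an arrival of the class of [k] minus the service of [k]; when [k] is
    available that service is just [s k], and otherwise the prefactor is zero. *)
Lemma update_directionE H k : is_root_path k (H k) ->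
  update_direction H L L' ord0 k =
  (available L k)%:R * ((a (class_of k))%:R - (s k)%:R).
Proof.
move=> [i [t [ri pt lt Hk]]]; rewrite mxE Hk path_increment// -(path_class pt) lt.
rewrite /served; case: (available L k); rewrite ?mul0r// andbT !mul1r.
by rewrite rmorphB /=.
Qed.

Lemma level_available_step j : (forall m, a m) -> (forall k, s k) ->
  level_available L j -> level_available L' j.+1.
Proof.
move=> a1 s1 /forallP Lj.
have av k : (rank k <= j)%N -> available L k by move/implyP: (Lj k).
have grow c : is_queue c -> queue_input a (served L s) c ->
    (available L c.2 -> (0 < L c)%N) -> (0 < L' c)%N.
  move=> qc inp pos; have := step qc; rewrite inp.
  rewrite /served s1 /=; case: (available L c.2) pos => [/(_ isT)|_];
    case: (L' c) => //; lia.
apply/forallP => k; apply/implyP => rk; rewrite /available.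
case: ifP => rt.
  by apply: grow; rewrite /is_queue /queue_input //= ?a1// /available rt.
apply/forallP => k'; apply/implyP; rewrite inE => e; apply: grow => //=.
- rewrite /queue_input /= /served s1 /= av//.
  by rewrite -ltnS (leq_trans (rank_edge e)).
- by rewrite /available rt => /forallP/(_ k'); rewrite inE e.
Qed.

End Step.

Lemma level_available0 L : level_available L 0.
Proof. by apply/forallP => k; rewrite leqNgt rank_gt0. Qed.

Lemma level_available_max L k : level_available L (nnode N) -> available L k.
Proof. by move/forallP/(_ k)/implyP; apply; exact: rank_le. Qed.

End Dynamics.

(** * Total mass and marginal means of products of Bernoulli laws *)

Section BernoulliSums.
Context (R : realType) (I : finType) (f : I -> R).

Lemma sum_bernoulli_pmf (q : R) :
  \sum_(b : bool) bernoulli_pmf q b = 1.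
Proof. by rewrite big_bool /bernoulli_pmf/=; ring. Qed.

Lemma sum_prod_bernoulli_pmf :
  \sum_(x : {ffun I -> bool}) \prod_i bernoulli_pmf (f i) (x i) = 1.
Proof.
rewrite -(bigA_distr_bigA (fun i b => bernoulli_pmf (f i) b)).
by rewrite big1// => i _; exact: sum_bernoulli_pmf.
Qed.

(** The factor [x i0] is absorbed into the [i0]-th term of the product; after exchanging sum and
    product, every other term sums to 1. *)
Lemma mean_prod_bernoulli_pmf i0 :
  \sum_(x : {ffun I -> bool}) (x i0)%:R * \prod_i bernoulli_pmf (f i) (x i) =
  f i0.
Proof.
pose F i (b : bool) : R := (if i == i0 then b%:R else 1) * bernoulli_pmf (f i) b.
transitivity (\sum_(x : {ffun I -> bool}) \prod_i F i (x i)).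
  apply: eq_bigr => x _; rewrite (bigD1 i0)//= [in RHS](bigD1 i0)//= {1}/F eqxx.
  rewrite mulrA; congr (_ * _); apply: eq_bigr => i /negPf ne.
  by rewrite /F ne mul1r.
rewrite -(bigA_distr_bigA F) (bigD1 i0)//= [X in _ * X]big1 ?mulr1; last first.
  move=> i /negPf ne; rewrite -(sum_bernoulli_pmf (f i)).
  by apply: eq_bigr => b _; rewrite /F ne mul1r.
by rewrite big_bool /F !eqxx /bernoulli_pmf/=; ring.
Qed.

End BernoulliSums.

(** * The allocation process *)

Section Process.
Context (R : realType) (N : network R) (lambda : 'I_(nclass N) -> R).
Hypothesis lambda01 : forall m, 0 < lambda m < 1.
Hypothesis lambda_cap : @capacity_region R N lambda.
Variable eps0 : R.
Hypothesis eps0_gt0 : 0 < eps0.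
Hypothesis eps0_le : forall k, eps0 <= nu lambda k / mu k.
Variable H : 'I_(nnode N) -> seq (queue N).
Hypothesis H_path : forall k, is_root_path k (H k).
Variable beta : nat -> R.
Hypothesis beta_gt0 : forall n, 0 < beta n.
Hypothesis beta_decr : nonincreasing_seq beta.
Context (d : measure_display) (T : measurableType d) (P : probability T R).
Variables (Q : nat -> queue N -> {RV P >-> nat})
  (p : nat -> 'I_(nnode N) -> {RV P >-> R})
  (a : nat -> 'I_(nclass N) -> {RV P >-> bool})
  (s : nat -> 'I_(nnode N) -> {RV P >-> bool}).
Hypothesis process : scheduled_process lambda eps0 beta H Q p a s.

Local Notation pstar := (\row_k (nu lambda k / mu k) : 'rV[R]_(nnode N)).

(** The family generating [history Q p n], named so that the lemmas on generated sigma-algebras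
    apply to it. *)
Definition generators n : set (set T) :=
  [set A | (exists i c Y,
                  [/\ (i <= n)%N, is_queue c & A = Q i c @^-1` Y]) \/
           (exists i k (Y : set R),
                  [/\ (i <= n)%N, measurable Y & A = p i k @^-1` Y])].

Local Notation F n := (<<s generators n>>).

Lemma generators_measurable n : generators n `<=` measurable.
Proof.
move=> A [[i [c [Y [_ _ ->]]]]|[i [k [Y [_ mY ->]]]]].
  exact: measurable_funPTI.
exact: measurable_funPTI.
Qed.

Lemma generators_mono i n : (i <= n)%N -> F i `<=` F n.
Proof.
move=> ij; apply: sub_sigma_algebra2.
move=> A [[l [c [Y [le qc ->]]]]|[l [k [Y [le mY ->]]]]]; [left|right].
  by exists l, c, Y; split=> //; exact: leq_trans ij.
by exists l, k, Y; split=> //; exact: leq_trans ij.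
Qed.

Lemma history_setT n : F n setT.
Proof. exact: (@measurableT _ (g_sigma_algebraType (generators n))). Qed.

Lemma allocated_feasible n w : feasible (allocated p n w).
Proof.
case: process => _ [p0 fp0 ap0] _ st _; case: n => [|n]; first by rewrite ap0.
by case: (st n w) => -[].
Qed.

Lemma allocated_ge n w : (0 < n)%N -> feasible_ge eps0 (allocated p n w).
Proof. by case: process => _ _ _ st _; case: n => // n _; case: (st n w). Qed.

Lemma alloc_adapted n k : sub_mfun (generators n) (p n k).
Proof.
move=> _ Y mY; rewrite setTI; apply: sub_sigma_algebra.
by right; exists n, k, Y.
Qed.

Lemma p_bounds n k w : 0 <= p n k w /\ mu k * p n k w < 1.
Proof.
have := feasible_ge0 k (allocated_feasible n w).
by have := feasible_mu_lt1 k (allocated_feasible n w); rewrite mxE.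
Qed.

Lemma alloc_bounded n k : bounded_mfun (p n k : T -> R).
Proof.
split; first exact: measurable_funPT.
exists (mu k)^-1 => w; have [h1 h2] := p_bounds n k w.
by rewrite ger0_norm// -[leRHS]mul1r ler_pdivlMr ?mu_gt0// mulrC ltW.
Qed.

Definition avail n k : set T := [set w | available (lengths Q n w) k].

Lemma queue_pos_history n c : is_queue c -> F n [set w | (0 < Q n c w)%N].
Proof.
move=> qc; apply: sub_sigma_algebra; left.
by exists n, c, [set l | (0 < l)%N].
Qed.

Lemma avail_history n k : F n (avail n k).
Proof.
rewrite /avail /available; have [rt|rt] := boolP (Defs.root k).
  exact: (@queue_pos_history n (None, k)).
rewrite (_ : [set _ | _] = \bigcap_(k' in [set k' | k' \in parents k])
    [set w | (0 < Q n (Some k', k) w)%N]).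
  apply: (@fin_bigcap_measurable _ (g_sigma_algebraType (generators n))) => //.
  by move=> k' /=; rewrite inE => e; exact: queue_pos_history.
apply/seteqP; split => w /=.
  by move=> /forallP h k' /= e; have := h k'; rewrite e.
by move=> h; apply/forallP => k'; apply/implyP => e; exact: (h k').
Qed.

Definition level n j : set T := [set w | level_available (lengths Q n w) j].

Lemma level_history n j : F n (level n j).
Proof.
rewrite (_ : level n j =
  \bigcap_(k in [set k | (rank k <= j)%N]) avail n k).
  apply: (@fin_bigcap_measurable _ (g_sigma_algebraType (generators n))) => //.
  by move=> k _; exact: avail_history.
apply/seteqP; split => w /=.
  by move=> /forallP h k /= e; have := h k; rewrite e.
by move=> h; apply/forallP => k; apply/implyP => e; exact: (h k).
Qed.

(** * Joint outcomes of arrivals and services, and the centred noise *)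

Definition outcome n (x : 'I_(nclass N) -> bool) (y : 'I_(nnode N) -> bool) : set T :=
  [set w | (forall m, a n m w = x m) /\ (forall k, s n k w = y k)].

Definition outcome_prob n (x : 'I_(nclass N) -> bool) (y : 'I_(nnode N) -> bool) w : R :=
  (\prod_m bernoulli_pmf (lambda m) (x m)) *
  (\prod_k bernoulli_pmf (mu k * p n k w) (y k)).

Lemma outcome_measurable n x y : measurable (outcome n x y).
Proof.
rewrite (_ : outcome n x y =
  (\bigcap_(m in setT) (a n m @^-1` [set x m])) `&`
  (\bigcap_(k in setT) (s n k @^-1` [set y k]))).
  by apply: measurableI; apply: fin_bigcap_measurable => // i _; exact: measurable_funPTI.
apply/seteqP; split => w /= -[h1 h2]; split=> i //=.
- by have := h1 i I.
- by have := h2 i I.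
Qed.

Lemma outcome_prob_bounded n x y : bounded_mfun (outcome_prob n x y).
Proof.
apply: bounded_mfunM; first exact: bounded_mfun_cst.
apply: bounded_mfun_prod => k; rewrite /bernoulli_pmf.
have b : bounded_mfun (fun w => mu k * p n k w).
  by apply: bounded_mfunM; [exact: bounded_mfun_cst | exact: alloc_bounded].
by case: (y k) => //; apply: bounded_mfunB => //; exact: bounded_mfun_cst.
Qed.

Lemma Ev_outcome n A x y : F n A ->
  Ev P (fun w => \1_A w * \1_(outcome n x y) w) =
  Ev P (fun w => \1_A w * outcome_prob n x y w).
Proof.
move=> FA; case: process => _ _ _ _ /(_ n x y) [_ _ /(_ A FA) cp].
have mA := sub_measurable (@generators_measurable n) FA.
have mB := outcome_measurable n x y.
rewrite [RHS]Ev_indicM// /Rintegral [X in fine X]cp.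
rewrite -(Ev_indic P (measurableI _ _ mA mB))/=.
by apply: eq_Ev => w; rewrite indicI.
Qed.

(** The outcomes form a finite partition, so a conditional mean of a function of the arrivals and
    services reduces to outcome probabilities. *)
Lemma sum_outcome n (h : ('I_(nclass N) -> bool) -> ('I_(nnode N) -> bool) -> R) w :
  h (fun m => a n m w) (fun k => s n k w) =
  \sum_(x : {ffun 'I_(nclass N) -> bool}) \sum_(y : {ffun 'I_(nnode N) -> bool})
    h x y * \1_(outcome n x y) w.
Proof.
pose x0 := [ffun m => a n m w]; pose y0 := [ffun k => s n k w].
have ex : (fun m => a n m w) = x0 by apply/funext => m; rewrite ffunE.
have ey : (fun k => s n k w) = y0 by apply/funext => m; rewrite ffunE.
rewrite ex ey (bigD1 x0)//= [X in _ + X]big1 ?addr0; last first.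
  move=> x ne; apply: big1 => y _; rewrite indicE memNset ?mulr0//.
  move=> [h1 _]; move/negP: ne; apply; apply/eqP/ffunP => m.
  by rewrite -h1 ffunE.
rewrite (bigD1 y0)//= big1 ?addr0.
  by rewrite indicE mem_set ?mulr1//; split=> i; rewrite ffunE.
move=> y ne; rewrite indicE memNset ?mulr0//.
move=> [_ h1]; move/negP: ne; apply; apply/eqP/ffunP => m.
by rewrite -h1 ffunE.
Qed.

(** A martingale difference: arrival minus potential service, centred by its conditional mean given
    the history up to time [n]. *)
Definition noise n k w : R :=
  ((a n (class_of k) w)%:R - (s n k w)%:R) - (nu lambda k - mu k * p n k w).

Lemma bool_bounded (X : {RV P >-> bool}) : bounded_mfun (fun w => (X w)%:R : R).
Proof.
rewrite (_ : (fun w => _) = \1_(X @^-1` [set true])).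
  by apply: bounded_mfun_indic; exact: measurable_funPTI.
apply/funext => w; rewrite indicE; case: (boolP (X w)) => Xw.
  by rewrite mem_set.
by rewrite memNset//= => h; rewrite h in Xw.
Qed.

Lemma noise_bounded n k : bounded_mfun (noise n k).
Proof.
apply: bounded_mfunB; apply: bounded_mfunB; try exact: bool_bounded.
  exact: bounded_mfun_cst.
by apply: bounded_mfunM; [exact: bounded_mfun_cst | exact: alloc_bounded].
Qed.

Lemma mean_outcome_prob n k w :
  \sum_(x : {ffun 'I_(nclass N) -> bool}) \sum_(y : {ffun 'I_(nnode N) -> bool})
    ((x (class_of k))%:R - (y k)%:R) * outcome_prob n x y w =
  nu lambda k - mu k * p n k w.
Proof.
pose X (x : {ffun 'I_(nclass N) -> bool}) := \prod_m bernoulli_pmf (lambda m) (x m).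
pose Y (y : {ffun 'I_(nnode N) -> bool}) :=
  \prod_k0 bernoulli_pmf (mu k0 * p n k0 w) (y k0).
transitivity (\sum_(x : {ffun 'I_(nclass N) -> bool}) ((x (class_of k))%:R * X x - X x * (mu k * p n k w))).
  apply: eq_bigr => x _.
  rewrite -(mean_prod_bernoulli_pmf (fun k0 => mu k0 * p n k0 w) k).
  transitivity ((x (class_of k))%:R * X x * (\sum_y Y y) -
      X x * \sum_(y : {ffun 'I_(nnode N) -> bool}) (y k)%:R * Y y); last first.
    by rewrite /Y sum_prod_bernoulli_pmf mulr1.
  rewrite !mulr_sumr -sumrB; apply: eq_bigr => y _; rewrite /outcome_prob -/(X x) -/(Y y).
  ring.
by rewrite /= sumrB mean_prod_bernoulli_pmf -mulr_suml sum_prod_bernoulli_pmf mul1r.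
Qed.

Lemma Ev_noise n k A : F n A -> Ev P (fun w => \1_A w * noise n k w) = 0.
Proof.
move=> FA; have mA := sub_measurable (@generators_measurable n) FA.
have bA : bounded_mfun (\1_A : T -> R) by exact: bounded_mfun_indic.
have bnu : bounded_mfun (fun w => nu lambda k - mu k * p n k w).
  apply: bounded_mfunB; first exact: bounded_mfun_cst.
  by apply: bounded_mfunM; [exact: bounded_mfun_cst | exact: alloc_bounded].
pose h (x : 'I_(nclass N) -> bool) (y : 'I_(nnode N) -> bool) : R :=
  (x (class_of k))%:R - (y k)%:R.
have b1 x y : bounded_mfun (fun w => h x y * (\1_A w * \1_(outcome n x y) w)).
  apply: bounded_mfunM; first exact: bounded_mfun_cst.
  by apply: bounded_mfunM => //; apply: bounded_mfun_indic; exact: outcome_measurable.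
have b2 x y : bounded_mfun (fun w => h x y * (\1_A w * outcome_prob n x y w)).
  apply: bounded_mfunM; first exact: bounded_mfun_cst.
  by apply: bounded_mfunM => //; exact: outcome_prob_bounded.
have bh : bounded_mfun (fun w => h (fun m => a n m w) (fun k => s n k w)).
  by apply: bounded_mfunB; exact: bool_bounded.
transitivity (Ev P (fun w => \1_A w * h (fun m => a n m w) (fun k => s n k w)) -
  Ev P (fun w => \1_A w * (nu lambda k - mu k * p n k w))).
  rewrite -EvB; [|by apply: bounded_mfunM|by apply: bounded_mfunM].
  by apply: eq_Ev => w; rewrite -mulrBr.
apply/eqP; rewrite subr_eq0; apply/eqP.
transitivity (Ev P (fun w => \sum_(x : {ffun 'I_(nclass N) -> bool})
  \sum_(y : {ffun 'I_(nnode N) -> bool}) h x y * (\1_A w * \1_(outcome n x y) w))).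
  apply: eq_Ev => w; rewrite sum_outcome mulr_sumr; apply: eq_bigr => x _.
  by rewrite mulr_sumr; apply: eq_bigr => y _; rewrite mulrCA.
transitivity (Ev P (fun w => \sum_(x : {ffun 'I_(nclass N) -> bool})
  \sum_(y : {ffun 'I_(nnode N) -> bool}) h x y * (\1_A w * outcome_prob n x y w))).
  rewrite !Ev_sum; try by move=> x; exact: bounded_mfun_sum.
  apply: eq_bigr => x _; rewrite !Ev_sum//; apply: eq_bigr => y _.
  rewrite !EvZ ?Ev_outcome//; first by apply: bounded_mfunM => //; exact: outcome_prob_bounded.
  by apply: bounded_mfunM => //; apply: bounded_mfun_indic; exact: outcome_measurable.
apply: eq_Ev => w; rewrite -mean_outcome_prob mulr_sumr; apply: eq_bigr => x _.
by rewrite mulr_sumr; apply: eq_bigr => y _; rewrite mulrCA.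
Qed.

(** * Lower bound on the probability that all nodes become available *)

Lemma step_of n w c : is_queue c ->
  (lengths Q n.+1 w c)%:Z = (lengths Q n w c)%:Z +
    (queue_input (fun m => a n m w) (served (lengths Q n w) (fun k => s n k w)) c)%:Z
    - (served (lengths Q n w) (fun k => s n k w) c.2)%:Z.
Proof. by case: process => _ _ st _ _; exact: st. Qed.

Definition busy_prob : R := (\prod_m lambda m) * (\prod_(k : 'I_(nnode N)) (mu k * eps0)).

Lemma busy_prob_gt0 : 0 < busy_prob.
Proof.
apply: mulr_gt0; apply: prodr_gt0 => i _; first by case/andP: (lambda01 i).
by rewrite mulr_gt0// mu_gt0.
Qed.

Local Notation busy n := (outcome n (fun=> true) (fun=> true)).

(** From time 1 on, the projection keeps every [p n k] at least [eps0]; the initial vector is only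
    known to be feasible, whence [0 < n]. *)
Lemma Ev_busy n A : (0 < n)%N -> F n A ->
  busy_prob * Ev P \1_A <= Ev P (fun w => \1_A w * \1_(busy n) w).
Proof.
move=> n0 FA; rewrite Ev_outcome//.
have mA := sub_measurable (@generators_measurable n) FA.
have bA : bounded_mfun (\1_A : T -> R) by exact: bounded_mfun_indic.
rewrite -EvZ//; apply: le_Ev.
- by apply: bounded_mfunM => //; exact: bounded_mfun_cst.
- by apply: bounded_mfunM => //; exact: outcome_prob_bounded.
move=> w; rewrite mulrC ler_wpM2l// /busy_prob /outcome_prob.
apply: ler_pM.
- by apply: prodr_ge0 => m _; case/andP: (lambda01 m) => /ltW.
- by apply: prodr_ge0 => k _; rewrite mulr_ge0// ltW// mu_gt0.
- by [].
apply: ler_prod => k _; apply/andP; split.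
  by rewrite mulr_ge0// ltW// mu_gt0.
rewrite /bernoulli_pmf ler_pM2l ?mu_gt0//.
by have [_ /(_ k)] := allocated_ge w n0; rewrite mxE.
Qed.

Lemma level_busy n j : level n j `&` busy n `<=` level n.+1 j.+1.
Proof.
move=> w [lv [a1 s1]]; apply: (level_available_step (@step_of n w)) lv.
- by move=> m; rewrite a1.
- by move=> k; rewrite s1.
Qed.

Lemma level_measurable n j : measurable (level n j).
Proof. exact: (sub_measurable (@generators_measurable n) (@level_history n j)). Qed.

(* The intermediate events [level (n + i) i] are in the history, unlike the
   arrivals and services themselves, so the bounds can be chained. *)
Lemma Ev_level n j A : (0 < n)%N -> F n A ->
  busy_prob ^+ j * Ev P \1_A <= Ev P (fun w => \1_A w * \1_(level (n + j) j) w).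
Proof.
move=> n0 FA; have mA := sub_measurable (@generators_measurable n) FA.
have bA : bounded_mfun (\1_A : T -> R) by exact: bounded_mfun_indic.
have bl i j' : bounded_mfun (\1_(level i j') : T -> R).
  by apply: bounded_mfun_indic; exact: level_measurable.
elim: j => [|j ih].
  rewrite expr0 mul1r le_eqVlt; apply/orP; left; apply/eqP/eq_Ev => w.
  by rewrite [X in _ * X]indicE mem_set ?mulr1//; exact: level_available0.
have FAl : F (n + j) (A `&` level (n + j) j).
  by apply: sub_setI; [exact: generators_mono (leq_addr _ _) _ FA|exact: level_history].
have nj0 : (0 < n + j)%N by rewrite addn_gt0 n0.
have := ler_wpM2l (ltW busy_prob_gt0) ih; rewrite mulrA -exprS => /le_trans; apply.
rewrite (@eq_Ev _ _ _ P _ \1_(A `&` level (n + j) j)); last first.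
  by move=> w; rewrite indicI.
apply: (le_trans (Ev_busy nj0 FAl)).
have bb : bounded_mfun (\1_(busy (n + j)) : T -> R).
  by apply: bounded_mfun_indic; exact: outcome_measurable.
apply: le_Ev.
- apply: bounded_mfunM => //; apply: bounded_mfun_indic.
  exact: (sub_measurable (@generators_measurable _) FAl).
- exact: bounded_mfunM.
move=> w; rewrite indicI /= -mulrA ler_wpM2l//.
rewrite -[X in X <= _]/((\1_(level (n + j) j) \* \1_(busy (n + j))) w) -indicI.
rewrite !indicE addnS ler_nat.
have [h|//] := boolP (w \in level (n + j) j `&` busy (n + j)).
by rewrite (mem_set (level_busy (set_mem h))).
Qed.

(** * Drift of the squared distance to the target *)

Definition sqerr n w : R := sqdist (allocated p n w) pstar.

Lemma sqerrE n w : sqerr n w = \sum_k (p n k w - nu lambda k / mu k) ^+ 2.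
Proof. by apply: eq_bigr => k _; rewrite !mxE. Qed.

Lemma sqerr_ge0 n w : 0 <= sqerr n w.
Proof. exact: sqdist_ge0. Qed.

Lemma err_bounded n k : bounded_mfun (fun w => p n k w - nu lambda k / mu k).
Proof. by apply: bounded_mfunB; [exact: alloc_bounded | exact: bounded_mfun_cst]. Qed.

Lemma err_adapted n k :
  sub_mfun (generators n) (fun w => p n k w - nu lambda k / mu k).
Proof.
by apply: measurable_funB; [exact: alloc_adapted | exact: measurable_cst].
Qed.

Lemma sqerr_bounded n : bounded_mfun (sqerr n).
Proof.
rewrite (_ : sqerr n = fun w => \sum_k (p n k w - nu lambda k / mu k) ^+ 2).
  apply: bounded_mfun_sum => k; under eq_fun do rewrite expr2.
  by apply: bounded_mfunM; exact: err_bounded.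
by apply/funext => w; exact: sqerrE.
Qed.

Lemma sqerr_adapted n : sub_mfun (generators n) (sqerr n).
Proof.
rewrite (_ : sqerr n = fun w => \sum_k (p n k w - nu lambda k / mu k) ^+ 2).
  apply: (@measurable_sum _ (g_sigma_algebraType (generators n))) => k.
  by apply: measurable_funX; exact: err_adapted.
by apply/funext => w; exact: sqerrE.
Qed.

Local Notation U n w := (update_direction H (lengths Q n w) (lengths Q n.+1 w)).

Lemma U_E n w k : U n w ord0 k =
  \1_(avail n k) w * ((a n (class_of k) w)%:R - (s n k w)%:R).
Proof.
rewrite (update_directionE (@step_of n w))// indicE; congr (_ * _).
have [h|h] := boolP (available (lengths Q n w) k); first by rewrite mem_set.
by rewrite memNset//=; exact/negP.
Qed.

Lemma U_sq_le1 n w k : (U n w ord0 k) ^+ 2 <= 1.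
Proof.
rewrite U_E indicE; case: (_ \in _); case: (a n _ w); case: (s n k w) => /=;
  rewrite ?(mul1r, mul0r, subrr, subr0, sub0r, sqrrN, expr1n, expr0n)//=; lra.
Qed.

Local Notation K := ((nnode N)%:R : R).

Lemma sum_U_sq_le n w : \sum_k (U n w ord0 k) ^+ 2 <= K.
Proof.
have : \sum_k (U n w ord0 k) ^+ 2 <= \sum_(k < nnode N) (1 : R).
  by apply: ler_sum => k _; exact: U_sq_le1.
by rewrite sumr_const card_ord.
Qed.

Lemma sqerr_step n w : sqerr n.+1 w <= sqerr n w + K * beta n ^+ 2 +
  2 * beta n * \sum_k (p n k w - nu lambda k / mu k) *
    (\1_(avail n k) w * ((a n (class_of k) w)%:R - (s n k w)%:R)).
Proof.
have pr : is_projection (feasible_ge eps0) (allocated p n w + beta n *: U n w)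
  (allocated p n.+1 w) by case: process.
have := projection_contracts (@feasible_ge_convex _ _ _) pr
  (target_feasible lambda_cap eps0_gt0 eps0_le).
move/le_trans; apply.
have -> : sqdist (allocated p n w + beta n *: U n w) pstar = sqerr n w +
    beta n ^+ 2 * (\sum_k (U n w ord0 k) ^+ 2) +
    2 * beta n * \sum_k (p n k w - nu lambda k / mu k) * U n w ord0 k.
  rewrite sqerrE !mulr_sumr -!big_split/=; apply: eq_bigr => k _.
  by rewrite 5!mxE; ring.
under [in leRHS]eq_bigr => k _ do rewrite -U_E.
rewrite lerD2r lerD2l mulrC.
by rewrite ler_wpM2r ?sqr_ge0 ?sum_U_sq_le.
Qed.

(** For [n > 0] the vector [p^n] is itself in the projection set, so contraction towards it bounds
    the length of one step by that of [beta n *: U]. *)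
Lemma sqerr_back n w : (0 < n)%N ->
  sqerr n w <= 2 * sqerr n.+1 w + 2 * K * beta n ^+ 2.
Proof.
move=> n0.
have pr : is_projection (feasible_ge eps0) (allocated p n w + beta n *: U n w)
  (allocated p n.+1 w) by case: process.
have h := projection_contracts (@feasible_ge_convex _ _ _) pr (allocated_ge w n0).
have h1 : sqdist (allocated p n.+1 w) (allocated p n w) <= K * beta n ^+ 2.
  apply: (le_trans h); rewrite [leLHS](_ : _ = (\sum_k (U n w ord0 k) ^+ 2) * beta n ^+ 2).
    by rewrite ler_wpM2r ?sqr_ge0 ?sum_U_sq_le.
  by rewrite mulr_suml; apply: eq_bigr => k _; rewrite 4!mxE; ring.
apply: (@le_trans _ _ (2 * sqerr n.+1 w +
    2 * sqdist (allocated p n.+1 w) (allocated p n w))); last first.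
  by rewrite lerD2l -mulrA ler_pM2l.
rewrite /sqerr /sqdist !mulr_sumr -big_split/=; apply: ler_sum => k _.
set x := allocated p n w ord0 k; set y := allocated p n.+1 w ord0 k.
(* This square is exactly the right-hand side minus the left-hand side. *)
by have := sqr_ge0 (x - pstar ord0 k - 2 * (y - pstar ord0 k)); nra.
Qed.

Lemma mu_lower : exists2 c : R, 0 < c & forall k : 'I_(nnode N), c <= mu k.
Proof.
(* The summand 1 keeps [S] positive even without nodes. *)
pose S : R := 1 + \sum_(k : 'I_(nnode N)) (mu k)^-1.
have inv_ge0 (k : 'I_(nnode N)) : 0 <= (mu k)^-1 by rewrite invr_ge0 ltW// mu_gt0.
have S0 : 0 < S by rewrite ltr_pwDl// sumr_ge0.
exists S^-1; first by rewrite invr_gt0.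
move=> k; rewrite -[leRHS]invrK lef_pV2 ?posrE ?invr_gt0 ?mu_gt0//.
rewrite /S (bigD1 k)//= addrCA lerDl addr_ge0// sumr_ge0//.
Qed.

Local Notation Lm := (nnode N).
Local Notation V n := (level n Lm).

Definition weighted_err n k w : R :=
  \1_(avail n k) w * (p n k w - nu lambda k / mu k).

(** The conditional mean of arrival minus service is [- mu k] times the error of node [k]. Each
    available node thus contributes a nonpositive drift, of which only the part on [V n] is kept,
    with [mu k] lowered to [c]. *)
Lemma sqerr_drift c n w : (forall k : 'I_(nnode N), c <= mu k) -> 0 < c ->
  sqerr n.+1 w <= sqerr n w + K * beta n ^+ 2 -
    2 * c * beta n * (\1_(V n) w * sqerr n w) +
    2 * beta n * \sum_k weighted_err n k w * noise n k w.
Proof.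
move=> cmu c0; apply: (le_trans (sqerr_step n w)).
rewrite -[leRHS]addrA lerD2l.
have -> : - (2 * c * beta n * (\1_(V n) w * sqerr n w)) +
    2 * beta n * (\sum_k weighted_err n k w * noise n k w) =
  2 * beta n * (\sum_k weighted_err n k w * noise n k w -
                c * (\1_(V n) w * sqerr n w)) by ring.
rewrite ler_pM2l ?mulr_gt0//.
rewrite sqerrE !mulr_sumr -sumrB; apply: ler_sum => k _.
rewrite /weighted_err /noise.
set x := p n k w - _; set b := (a n _ w)%:R - _.
have -> : nu lambda k - mu k * p n k w = - mu k * x.
  by rewrite /x; field; rewrite lt0r_neq0// mu_gt0.
suff : c * (\1_(V n) w * x ^+ 2) <= mu k * (\1_(avail n k) w * x ^+ 2).
  by rewrite -subr_ge0 => h; rewrite -subr_ge0; move: h; congr (0 <= _); ring.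
apply: ler_pM => //; first exact: ltW.
  by rewrite mulr_ge0 ?sqr_ge0.
rewrite ler_wpM2r ?sqr_ge0// !indicE ler_nat.
have [h|//] := boolP (w \in V n).
have h' : avail n k w := level_available_max k (set_mem h).
by rewrite (mem_set h').
Qed.

Lemma weighted_err_bounded n k : bounded_mfun (weighted_err n k).
Proof.
apply: bounded_mfunM; last exact: err_bounded.
apply: bounded_mfun_indic.
exact: (sub_measurable (@generators_measurable n) (@avail_history n k)).
Qed.

Lemma history_indic n A : F n A -> sub_mfun (generators n) (\1_A : T -> R).
Proof. by move=> FA; apply: (@measurable_indic _ (g_sigma_algebraType (generators n))). Qed.

Lemma weighted_err_adapted n k : sub_mfun (generators n) (weighted_err n k).
Proof.
apply: measurable_funM; last exact: err_adapted.
exact: (history_indic (@avail_history n k)).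
Qed.

(** The noise drops out because its weights are known at time [n]. The set [A] is the whole space
    for the recursion on means, and arbitrary in the history for the supermartingale property. *)
Lemma Ev_sqerr_drift c n A : (forall k : 'I_(nnode N), c <= mu k) -> 0 < c ->
  F n A ->
  Ev P (fun w => \1_A w * sqerr n.+1 w) <=
  Ev P (fun w => \1_A w * sqerr n w) + K * beta n ^+ 2 * Ev P \1_A -
  2 * c * beta n * Ev P (fun w => \1_A w * (\1_(V n) w * sqerr n w)).
Proof.
move=> cmu c0 FA; have mA := sub_measurable (@generators_measurable n) FA.
have bA : bounded_mfun (\1_A : T -> R) by exact: bounded_mfun_indic.
have bX i := sqerr_bounded i.
have bV : bounded_mfun (\1_(V n) : T -> R).
  by apply: bounded_mfun_indic; exact: level_measurable.
have bh k : bounded_mfun (fun w => (\1_A w * weighted_err n k w) * noise n k w).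
  apply: bounded_mfunM; last exact: noise_bounded.
  by apply: bounded_mfunM => //; exact: weighted_err_bounded.
have z k : Ev P (fun w => (\1_A w * weighted_err n k w) * noise n k w) = 0.
  apply: (Ev_mul_eq0 (@generators_measurable n)).
  - exact: noise_bounded.
  - by apply: bounded_mfunM => //; exact: weighted_err_bounded.
  - apply: measurable_funM; first exact: history_indic.
    exact: weighted_err_adapted.
  - by move=> B; exact: Ev_noise.
pose f1 w := \1_A w * sqerr n w.
pose f2 w := K * beta n ^+ 2 * \1_A w.
pose f3 w := 2 * c * beta n * (\1_A w * (\1_(V n) w * sqerr n w)).
pose f4 w := 2 * beta n * \sum_k (\1_A w * weighted_err n k w) * noise n k w.
have b1 : bounded_mfun f1 by exact: bounded_mfunM.
have b2 : bounded_mfun f2 by apply: bounded_mfunM => //; exact: bounded_mfun_cst.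
have bAV : bounded_mfun (fun w => \1_A w * (\1_(V n) w * sqerr n w)).
  by apply: bounded_mfunM => //; exact: bounded_mfunM.
have b3 : bounded_mfun f3 by apply: bounded_mfunM => //; exact: bounded_mfun_cst.
have bs : bounded_mfun (fun w => \sum_k (\1_A w * weighted_err n k w) * noise n k w).
  exact: bounded_mfun_sum.
have b4 : bounded_mfun f4 by apply: bounded_mfunM => //; exact: bounded_mfun_cst.
apply: (@le_trans _ _ (Ev P (fun w => f1 w + f2 w - f3 w + f4 w))).
  apply: le_Ev.
  - exact: bounded_mfunM.
  - by apply: bounded_mfunD => //; apply: bounded_mfunB => //; exact: bounded_mfunD.
  move=> w; have := sqerr_drift n w cmu c0.
  have A0 : 0 <= \1_A w :> R by rewrite indicE.
  move=> /(ler_wpM2l A0) /le_trans; apply; rewrite /f1 /f2 /f3 /f4.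
  rewrite le_eqVlt; apply/orP; left; apply/eqP.
  under [in RHS]eq_bigr => k _ do rewrite -mulrA.
  by rewrite -mulr_sumr; ring.
rewrite EvD//; last by apply: bounded_mfunB => //; exact: bounded_mfunD.
rewrite EvB//; last exact: bounded_mfunD.
rewrite EvD// /f2 /f3 /f4 !EvZ// Ev_sum//.
have -> : \sum_k Ev P (fun w => (\1_A w * weighted_err n k w) * noise n k w) = 0.
  exact: big1.
by rewrite mulr0 addr0.
Qed.

(** As [beta] decreases, the errors add up to at most the geometric sum
    [2 * K * (1 + ... + 2 ^+ j.-1)] times [beta n ^+ 2]. *)
Lemma sqerr_back_iter n j w : (0 < n)%N ->
  sqerr n w <= 2 ^+ j * sqerr (n + j) w + 2 ^+ j.+1 * K * beta n ^+ 2.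
Proof.
move=> n0; elim: j => [|j ih].
  by rewrite expr0 mul1r addn0 lerDl mulr_ge0 ?sqr_ge0// mulr_ge0.
apply: (le_trans ih).
have nj : (0 < n + j)%N by rewrite addn_gt0 n0.
have b2 : beta (n + j)%N ^+ 2 <= beta n ^+ 2.
  by rewrite ler_sqr ?nnegrE ?(ltW (beta_gt0 _))//; apply: beta_decr; rewrite leq_addr.
have h : sqerr (n + j) w <= 2 * sqerr (n + j.+1) w + 2 * K * beta n ^+ 2.
  rewrite addnS; apply: (le_trans (sqerr_back w nj)).
  by rewrite lerD2l ler_wpM2l// mulr_ge0.
have e0 : 0 <= 2 ^+ j :> R by rewrite exprn_ge0.
have := ler_wpM2l e0 h; rewrite !exprS; nra.
Qed.

Lemma Ev_sqerr_le n : (0 < n)%N ->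
  busy_prob ^+ Lm * Ev P (sqerr n) <=
  2 ^+ Lm * Ev P (fun w => \1_(V (n + Lm)) w * sqerr (n + Lm) w) +
  2 ^+ Lm.+1 * K * beta n ^+ 2.
Proof.
move=> n0.
have bV : bounded_mfun (\1_(V (n + Lm)) : T -> R).
  by apply: bounded_mfun_indic; exact: level_measurable.
have bX i := sqerr_bounded i.
have bc r : bounded_mfun (cst r : T -> R) by exact: bounded_mfun_cst.
(* By [Ev_level], [phi] has nonnegative mean on every set of the history at time [n], hence also
   against the adapted weight [sqerr n]. *)
pose phi w : R := \1_(V (n + Lm)) w - busy_prob ^+ Lm.
have bphi : bounded_mfun phi by apply: bounded_mfunB => //; exact: bc.
have : 0 <= Ev P (fun w => sqerr n w * phi w).
  apply: (Ev_mul_ge0 (@generators_measurable n) bphi (bX n) (@sqerr_adapted n)).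
    by move=> w; exact: sqerr_ge0.
  move=> A FA; have mA := sub_measurable (@generators_measurable n) FA.
  have bA : bounded_mfun (\1_A : T -> R) by exact: bounded_mfun_indic.
  rewrite (@eq_Ev _ _ _ P _ (fun w => \1_A w * \1_(V (n + Lm)) w -
    busy_prob ^+ Lm * \1_A w)); last by move=> w; rewrite /phi; ring.
  rewrite EvB ?EvZ ?subr_ge0//; [exact: Ev_level | exact: bounded_mfunM |
    by apply: bounded_mfunM => //; exact: bc].
rewrite (@eq_Ev _ _ _ P _ (fun w => \1_(V (n + Lm)) w * sqerr n w -
    busy_prob ^+ Lm * sqerr n w)); last by move=> w; rewrite /phi; ring.
rewrite EvB ?EvZ ?subr_ge0//; [|exact: bounded_mfunM |
  by apply: bounded_mfunM => //; exact: bc].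
move=> /le_trans; apply.
pose g w := 2 ^+ Lm * (\1_(V (n + Lm)) w * sqerr (n + Lm) w) +
  2 ^+ Lm.+1 * K * beta n ^+ 2.
have bVX : bounded_mfun (fun w => \1_(V (n + Lm)) w * sqerr (n + Lm) w).
  exact: bounded_mfunM.
have bVX2 : bounded_mfun (fun w => 2 ^+ Lm * (\1_(V (n + Lm)) w * sqerr (n + Lm) w)).
  by apply: bounded_mfunM => //; exact: bc.
apply: (@le_trans _ _ (Ev P g)); last first.
  by rewrite /g EvD; [rewrite (EvZ P _ bVX) Ev_cst | | exact: bc].
apply: le_Ev; [exact: bounded_mfunM|by apply: bounded_mfunD => //; exact: bc|].
move=> w; rewrite /g indicE; case: (_ \in _); last first.
  by rewrite !mul0r mulr0 add0r mulr_ge0 ?sqr_ge0// mulr_ge0 ?exprn_ge0.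
by rewrite !mul1r; exact: sqerr_back_iter.
Qed.

(** * Convergence in mean, then almost surely *)

Hypothesis beta_sum : series beta @ \oo --> +oo.
Hypothesis beta_sum2 : cvgn (series (fun n => beta n ^+ 2)).

Lemma Ev_sqerr_cvg0 : Ev P (sqerr n) @[n --> \oo] --> 0.
Proof.
have [c c0 cmu] := mu_lower.
have q0 : 0 < busy_prob ^+ Lm by rewrite exprn_gt0// busy_prob_gt0.
apply: (@robbins_monro_cvg0 _ beta (fun n => Ev P (sqerr n))
  (fun n => Ev P (fun w => \1_(V n) w * sqerr n w)) (2 * c) K
  (2 ^+ Lm / busy_prob ^+ Lm) (2 ^+ Lm.+1 * K / busy_prob ^+ Lm) Lm 1) => //.
- by rewrite mulr_gt0.
- by rewrite divr_gt0// exprn_gt0.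
- by move=> n; apply: Ev_ge0 => w; exact: sqerr_ge0.
- by move=> n; apply: Ev_ge0 => w; rewrite mulr_ge0// sqerr_ge0.
- move=> n; have := Ev_sqerr_drift cmu c0 (@history_setT n).
  have one f : Ev P (fun w => \1_[set: T] w * f w) = Ev P f.
    by apply: eq_Ev => w; rewrite indicT mul1r.
  by rewrite !one indicT Ev_cst mulr1 addrAC.
- move=> n n1; have := Ev_sqerr_le n1.
  rewrite mulrC -ler_pdivlMr// => /le_trans; apply.
  rewrite mulrDl le_eqVlt; apply/orP; left; apply/eqP; ring.
Qed.

Lemma sqerr_ae_cvg0 : {ae P, forall w, sqerr n w @[n --> \oo] --> 0}.
Proof.
have [c c0 cmu] := mu_lower.
pose t := sq_tail beta; have t0 n : 0 <= K * t n by rewrite mulr_ge0// sq_tail_ge0.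
pose Y n w := sqerr n w + K * t n.
have ct : K * t n @[n --> \oo] --> 0.
  by rewrite -[X in _ --> X](mulr0 K); apply: cvgMl_tmp; exact: sq_tail_cvg0.
have bX i := sqerr_bounded i.
have bc r : bounded_mfun (cst r : T -> R) by exact: bounded_mfun_cst.
have bY n : bounded_mfun (Y n) by apply: bounded_mfunD => //; exact: bc.
have : {ae P, forall w, Y n w @[n --> \oo] --> 0}.
  apply: (supermartingale_ae_cvg0 generators_measurable generators_mono _ bY).
  - by move=> n w; rewrite addr_ge0// sqerr_ge0.
  - move=> n; apply: measurable_funD; first exact: sqerr_adapted.
    exact: measurable_cst.
  - move=> n A FA; have mA := sub_measurable (@generators_measurable n) FA.
    have bA : bounded_mfun (\1_A : T -> R) by exact: bounded_mfun_indic.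
    have EY m i : Ev P (fun w => \1_A w * (sqerr m w + K * t i)) =
        Ev P (fun w => \1_A w * sqerr m w) + K * t i * Ev P \1_A.
      rewrite -EvZ// -EvD; [|exact: bounded_mfunM |
  by apply: bounded_mfunM => //; exact: bc].
      by apply: eq_Ev => w; ring.
    rewrite !EY /t (sq_tailS beta n) -/t.
    have := Ev_sqerr_drift cmu c0 FA.
    have : 0 <= 2 * c * beta n * Ev P (fun w => \1_A w * (\1_(V n) w * sqerr n w)).
      apply: mulr_ge0; first by rewrite !mulr_ge0// ltW.
      apply: Ev_ge0 => w.
      by rewrite !mulr_ge0// sqerr_ge0.
    nra.
  - rewrite (_ : (fun n => Ev P (Y n)) = (fun n => Ev P (sqerr n) + K * t n)).
      by rewrite -[X in _ --> X]addr0; apply: cvgD => //; exact: Ev_sqerr_cvg0.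
    by apply/funext => n; rewrite EvD; [rewrite Ev_cst | | exact: bc].
apply: filterS => w cY.
apply: (@squeeze_cvgr _ _ _ _ (cst 0) (Y ^~ w)) => //.
  by apply: nearW => n; rewrite sqerr_ge0/= lerDl.
exact: cvg_cst.
Qed.

Lemma allocated_ae_cvg :
  {ae P, forall w, allocated p n w @[n --> \oo] --> pstar}.
Proof.
apply: filterS sqerr_ae_cvg0 => w /cvgr0Pnorm_le cX.
apply/cvgrPdist_le => e e0.
have e2 : 0 < e ^+ 2 by rewrite exprn_gt0.
apply: filterS (cX _ e2) => n; rewrite ger0_norm ?sqerr_ge0// => h.
(* The norm on row vectors is the maximum norm, and the square of each coordinate error is one term
   of [sqerr n w]. *)
rewrite [leLHS]/Num.Def.normr/= mx_normrE; apply: bigmax_le => [|[i k] _]; first exact: ltW.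
rewrite ord1 !mxE/= -ler_sqr ?nnegrE ?(ltW e0)//.
rewrite real_normK ?num_real//; apply: le_trans h.
rewrite sqerrE (bigD1 k)//= -[X in X <= _]addr0 lerD//.
  by rewrite -sqrrN opprB.
by apply: sumr_ge0 => j _; exact: sqr_ge0.
Qed.

End Process.

Theorem theorem1 (R : realType) (N : network R)
  (lambda : 'I_(nclass N) -> R)
  (lambda01 : forall m, 0 < lambda m < 1)
  (lambda_cap : @capacity_region R N lambda)
  (eps0 : R) (eps0_gt0 : 0 < eps0)
  (eps0_le : forall k, eps0 <= nu lambda k / mu k)
  (H : 'I_(nnode N) -> seq (queue N))
  (H_path : forall k, is_root_path k (H k))
  (beta : nat -> R)
  (beta_gt0 : forall n, 0 < beta n)
  (beta_decr : nonincreasing_seq beta)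
  (beta_sum : series beta @ \oo --> +oo)
  (beta_sum2 : cvgn (series (fun n => beta n ^+ 2)))
  (beta_lim : cvgn (fun n => 1 / (n%:R * beta n)))
  (d : measure_display) (T : measurableType d) (P : probability T R)
  (Q : nat -> queue N -> {RV P >-> nat})
  (p : nat -> 'I_(nnode N) -> {RV P >-> R})
  (a : nat -> 'I_(nclass N) -> {RV P >-> bool})
  (s : nat -> 'I_(nnode N) -> {RV P >-> bool})
  (process : scheduled_process lambda eps0 beta H Q p a s) :
  {ae P, forall w,
    allocated p n w @[n --> \oo] --> (\row_k (nu lambda k / mu k) : 'rV[R]_(nnode N))}.
Proof.
exact: (allocated_ae_cvg lambda01 lambda_cap eps0_gt0 eps0_le H_path beta_gt0
  beta_decr process beta_sum beta_sum2).
Qed.
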